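(* Let $\Omega$ be a bounded strictly convex domain in $\mathbf{R}^n$ or $S^n$ with diameter $d$, let $V:\Omega\to\mathbf{R}$ be nonnegative, convex and smooth, and let $\lambda_1,\lambda_2$ be the first two Dirichlet eigenvalues of $-\Delta+V$ on $\Omega$. Let the midrange $a$ and the quantity $\alpha$ be as defined in the context. If $a=0$, then $$\lambda_2-\lambda_1\ \geq\ \frac{\pi^2}{d^2}+\alpha .$$
   Context: $\mathbf{R}^n$ and $S^n$ carry their standard metrics. ''Strictly convex'' means that the second fundamental form of the (smooth) boundary $\partial\Omega$ with respect to the outward normal is positive definite (sign convention: positive definite for small round balls). The eigenvalue problem is $-\Delta u+Vu=\lambda u$ in $\Omega$, $u=0$ on $\partial\Omega$. Let $f>0$ be a first eigenfunction and $f_2$ a second eigenfunction. The ratio $f_2/f$ changes sign in $\Omega$ and is smooth up to $\partial\Omega$; $f_2$ is normalized so that $\sup_\Omega f_2/f=1$ and $\inf_\Omega f_2/f=-k$ with $0<k\le1$. Put $a=\frac{1-k}{1+k}\in[0,1)$, called the midrange of $f_2/f$. Put $\alpha=\inf_{x\in\Omega}\inf_{\tau\in T_x\Omega,\,|\tau|=1}[\nabla^2(-\ln f)](\tau,\tau)(x)$. *)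

(* Defs.v *)
(* World: MathComp / MathComp-Analysis. *)
From HB Require Import structures.
From mathcomp Require Import all_boot all_order all_algebra.
From mathcomp Require Import all_classical all_reals all_analysis.
Set Implicit Arguments.
Unset Strict Implicit.
Unset Printing Implicit Defensive.
Import Order.TTheory GRing.Theory Num.Theory.
Import numFieldNormedType.Exports.
Local Open Scope classical_set_scope.
Local Open Scope ring_scope.

(* The library norm on row vectors is the sup norm (same topology); the
   Euclidean structure is given here. *)
Definition dot (R : realType) (m : nat) (x y : 'rV[R]_m) : R :=
  \sum_(i < m) x 0 i * y 0 i.

Definition norm2 (R : realType) (m : nat) (x : 'rV[R]_m) : R :=
  Num.sqrt (dot x x).

(* R^n, or S^n realized as the unit sphere of R^(n+1). Functions on a subset of
   S^n are represented by functions on R^(n+1) whose values off that subset are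
   irrelevant. *)
Variant space_form := Euclidean | Sphere.

Definition ambient_dim (M : space_form) (n : nat) : nat :=
  if M is Sphere then n.+1 else n.

Notation ambient R M n := 'rV[R]_(ambient_dim M n).

Definition points (R : realType) (M : space_form) (n : nat) :
    set (ambient R M n) :=
  if M is Sphere then [set x | dot x x = 1] else setT.

Definition tangent (R : realType) (M : space_form) (n : nat)
    (x : ambient R M n) : set (ambient R M n) :=
  if M is Sphere then [set v | dot x v = 0] else setT.

Definition tproj (R : realType) (M : space_form) (n : nat)
    (x y : ambient R M n) : ambient R M n :=
  if M is Sphere then y - dot x y *: x else y.

(* The geodesic t |-> exp_x (t v); since 0^-1 = 0 it is constant when v = 0. *)
Definition geodesic (R : realType) (M : space_form) (n : nat)
    (x v : ambient R M n) (t : R) : ambient R M n :=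
  if M is Sphere then
    cos (t * norm2 v) *: x + (sin (t * norm2 v) / norm2 v) *: v
  else x + t *: v.

Definition gdist (R : realType) (M : space_form) (n : nat)
    (x y : ambient R M n) : R :=
  if M is Sphere then acos (dot x y) else norm2 (x - y).

Definition diameter (R : realType) (M : space_form) (n : nat)
    (Om : set (ambient R M n)) : R :=
  sup [set gdist x y | x in Om & y in Om].

Fixpoint Ck (R : realType) (m k : nat) (U : set 'rV[R]_m) (g : 'rV[R]_m -> R) :
    Prop :=
  if k is k'.+1 then
    (forall x, U x -> differentiable g x) /\
    (forall v, Ck k' U (fun x => 'D_v g x))
  else forall x, U x -> {for x, continuous g}.

Definition smooth (R : realType) (m : nat) (U : set 'rV[R]_m)
    (g : 'rV[R]_m -> R) : Prop :=
  forall k, Ck k U g.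

(* u restricted to Om extends smoothly to a neighborhood of A in the ambient
   vector space. For Om open in R^n or in S^n and A = Om this is smoothness of u
   on Om. *)
Definition smooth_near (R : realType) (m : nat) (A Om : set 'rV[R]_m)
    (u : 'rV[R]_m -> R) : Prop :=
  exists U g, [/\ open U, A `<=` U, smooth U g & forall x, Om x -> g x = u x].

Definition smooth_in (R : realType) (m : nat) (Om : set 'rV[R]_m)
    (u : 'rV[R]_m -> R) : Prop :=
  smooth_near Om Om u.

Definition smooth_up_to_boundary (R : realType) (m : nat) (Om : set 'rV[R]_m)
    (u : 'rV[R]_m -> R) : Prop :=
  smooth_near (closure Om) Om u.

(* The Riemannian Hessian (nabla^2 u)(v,v) at x: second derivative at t = 0 of
   u along the geodesic through x with velocity v. *)
Definition hess (R : realType) (M : space_form) (n : nat)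
    (u : ambient R M n -> R) (x v : ambient R M n) : R :=
  derive1n 2 (fun t : R => u (geodesic x v t)) 0.

Definition orthonormal_frame (R : realType) (M : space_form) (n : nat)
    (x : ambient R M n) (e : 'I_n -> ambient R M n) : Prop :=
  (forall i, tangent x (e i)) /\ (forall i j, dot (e i) (e j) = (i == j)%:R).

(* c is the Laplacian of u at x: the trace of the Hessian. *)
Definition is_laplacian (R : realType) (M : space_form) (n : nat)
    (u : ambient R M n -> R) (x : ambient R M n) (c : R) : Prop :=
  forall e : 'I_n -> ambient R M n, orthonormal_frame x e ->
    c = \sum_(i < n) hess u x (e i).

Definition domain (R : realType) (M : space_form) (n : nat)
    (Om : set (ambient R M n)) : Prop :=
  [/\ exists2 U : set (ambient R M n), open U & Om = U `&` @points R M n,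
      Om !=set0 & connected Om].

(* For Om relatively open, this is the topological boundary of Om in the space;
   S^n being closed, closures may be taken in the ambient space. *)
Definition boundary (R : realType) (m : nat) (Om : set 'rV[R]_m) :
    set 'rV[R]_m :=
  closure Om `\` Om.

Definition grad (R : realType) (m : nat) (g : 'rV[R]_m -> R) (x : 'rV[R]_m) :
    'rV[R]_m :=
  \row_i 'D_(delta_mx 0 i) g x.

(* Gradient in R^n or S^n of the restriction of an ambient function. *)
Definition tgrad (R : realType) (M : space_form) (n : nat)
    (g : ambient R M n -> R) (x : ambient R M n) : ambient R M n :=
  tproj x (grad g x).

Definition local_defining_function (R : realType) (M : space_form) (n : nat)
    (Om U : set (ambient R M n)) (rho : ambient R M n -> R)
    (p : ambient R M n) : Prop :=
  [/\ open U /\ U p, smooth U rho,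
      forall x, U x -> points x -> (Om x <-> rho x < 0) &
      tgrad rho p != 0].

Definition smooth_boundary (R : realType) (M : space_form) (n : nat)
    (Om : set (ambient R M n)) : Prop :=
  forall p, boundary Om p -> exists U rho, local_defining_function Om U rho p.

(* On the boundary {rho = 0} of {rho < 0}, the outward unit normal field. *)
Definition outward_normal (R : realType) (M : space_form) (n : nat)
    (rho : ambient R M n -> R) (x : ambient R M n) : ambient R M n :=
  (norm2 (tgrad rho x))^-1 *: tgrad rho x.

(* II(tau,tau) = <nabla_tau nu, tau> with nu the outward unit normal; on S^n the
   ambient derivative differs from nabla_tau nu by a multiple of p, which is
   orthogonal to tau. Equal to |tau|^2 / r on the sphere of radius r in R^n. *)
Definition second_fundamental_form (R : realType) (M : space_form) (n : nat)
    (rho : ambient R M n -> R) (p tau : ambient R M n) : R :=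
  dot ('D_tau (outward_normal rho) p) tau.

Definition geodesically_convex (R : realType) (M : space_form) (n : nat)
    (Om : set (ambient R M n)) : Prop :=
  forall x v : ambient R M n, Om x -> tangent x v -> Om (geodesic x v 1) ->
    gdist x (geodesic x v 1) = norm2 v ->
    forall t : R, 0 <= t <= 1 -> Om (geodesic x v t).

(* In dimension n >= 2 convexity follows from positivity of II; in dimension 1
   that condition is void, and arcs of S^1 longer than pi are not convex. *)
Definition strictly_convex (R : realType) (M : space_form) (n : nat)
    (Om : set (ambient R M n)) : Prop :=
  geodesically_convex Om /\
  forall U rho p, boundary Om p -> local_defining_function Om U rho p ->
    forall tau, tangent p tau -> dot tau (tgrad rho p) = 0 -> tau != 0 ->
      0 < second_fundamental_form rho p tau.

Definition convex_potential (R : realType) (M : space_form) (n : nat)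
    (Om : set (ambient R M n)) (V : ambient R M n -> R) : Prop :=
  forall x v : ambient R M n, tangent x v ->
    (forall s : R, 0 <= s <= 1 -> Om (geodesic x v s)) ->
    forall t : R, 0 <= t <= 1 ->
      V (geodesic x v t) <= (1 - t) * V x + t * V (geodesic x v 1).

Definition eigenfunction (R : realType) (M : space_form) (n : nat)
    (Om : set (ambient R M n)) (V : ambient R M n -> R) (lam : R)
    (u : ambient R M n -> R) : Prop :=
  [/\ smooth_in Om u /\ {within closure Om, continuous u},
      forall x, boundary Om x -> u x = 0,
      exists2 x, Om x & u x != 0 &
      forall x, Om x -> exists2 lapu, is_laplacian u x lapu &
        - lapu + V x * u x = lam * u x].

Definition independent_on (R : realType) (m : nat) (Om : set 'rV[R]_m)
    (u w : 'rV[R]_m -> R) : Prop :=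
  forall a b : R, (forall x, Om x -> a * u x + b * w x = 0) ->
    a = 0 /\ b = 0.

(* The two lowest Dirichlet eigenvalues, counted with multiplicity. *)
Definition first_two_eigenvalues (R : realType) (M : space_form) (n : nat)
    (Om : set (ambient R M n)) (V : ambient R M n -> R) (lam1 lam2 : R) : Prop :=
  exists u1 u2 : ambient R M n -> R,
    [/\ eigenfunction Om V lam1 u1 /\ eigenfunction Om V lam2 u2,
        independent_on Om u1 u2,
        (forall mu w, eigenfunction Om V mu w -> lam1 <= mu) &
        (forall mu w, eigenfunction Om V mu w -> independent_on Om u1 w ->
           lam2 <= mu)].

Definition midrange (R : realType) (k : R) : R := (1 - k) / (1 + k).

Definition alpha (R : realType) (M : space_form) (n : nat)
    (Om : set (ambient R M n)) (f : ambient R M n -> R) : \bar R :=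
  ereal_inf [set ereal_inf [set (hess (fun y => - ln (f y)) x tau)%:E
                           | tau in [set tau | tangent x tau /\ norm2 tau = 1]]
            | x in Om].

(* Main.v *)
(* The quotient v = f2 / f solves Lap v + 2 <grad ln f, grad v> = - lam v with
   lam = lam2 - lam1, and ln f is alpha-concave along geodesics. Let w solve the
   one-dimensional comparison inequality w'' - 2 alpha s w' <= - mu w, where
   mu = alpha + be^2 and be < pi / d. If lam < mu and
     v y - v x <= 2 C w (d(x, y) / 2)   for all x, y in the domain,
   the maximum principle applied to
     v y - v x - 2 C' w (d(x, y) / 2) + eps (ln f x + ln f y)
   gives the same inequality for a constant C' < C, so that v is constant, which
   is absurd; hence lam >= mu, and be tends to pi / d. Since - ln f blows up at
   the boundary and (Lap + 2 <grad ln f, grad>) (- ln f) <= lam1, the penalty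
   keeps the maximum inside the domain at a cost O(eps): neither the boundary
   behaviour of v nor the curvature of the boundary is needed. All derivatives
   are taken along geodesics, and the distance is only bounded from above by
   smooth functions, so antipodal points of the sphere need no separate
   treatment in the second variation. *)
Require Import Defs.
From HB Require Import structures.
From mathcomp Require Import all_boot all_order all_algebra.
From mathcomp Require Import all_classical all_reals all_analysis.
From mathcomp Require Import ring lra.
Set Implicit Arguments.
Unset Strict Implicit.
Unset Printing Implicit Defensive.
Import Order.TTheory GRing.Theory Num.Theory.
Import numFieldNormedType.Exports.
Local Open Scope classical_set_scope.
Local Open Scope ring_scope.

(** * Second-order jets of real functions *)

Definition jet2 {R : realType} (h : R -> R) (t a b : R) : Prop :=
  exists h1 : R -> R, [/\ \forall s \near t, is_derive (s : R) 1 h (h1 s),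
    h1 t = a & is_derive t 1 h1 b].

Section Jet.
Context {R : realType}.
Implicit Types (h k : R -> R) (s t a b c d : R).

Lemma jet2_is_derive h t a b : jet2 h t a b -> is_derive t 1 h a.
Proof. by case=> h1 [/nbhs_singleton hd <- _]. Qed.

Lemma jet2_near_eq h k t a b : (\forall s \near t, h s = k s) ->
  jet2 h t a b -> jet2 k t a b.
Proof.
move=> hk [h1 [hd h1t h1d]]; exists h1; split; [|by []|exact: h1d].
have hk' : \forall s \near t, {near s, h =1 k} by apply: near_join.
near=> s.
have hs : is_derive s 1 h (h1 s) by near: s.
apply: near_eq_is_derive hs.
by near: s.
Unshelve. all: by end_near. Qed.

Lemma jet2_eq h k t a b a' b' : h =1 k -> a = a' -> b = b' ->
  jet2 h t a b -> jet2 k t a' b'.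
Proof. by move=> /funext -> -> ->. Qed.

Lemma jet2D h k t a b c d : jet2 h t a b -> jet2 k t c d ->
  jet2 (fun s => h s + k s) t (a + c) (b + d).
Proof.
move=> [h1 [hd <- h1d]] [k1 [kd <- k1d]]; exists (fun s => h1 s + k1 s).
split; [|by []|exact: (is_deriveD h1d k1d)]; near=> s.
have hs : is_derive s 1 h (h1 s) by near: s.
have ks : is_derive s 1 k (k1 s) by near: s.
exact: (is_deriveD hs ks).
Unshelve. all: by end_near. Qed.

Lemma is_deriveMl h t a c : is_derive t 1 h a ->
  is_derive t 1 (fun s => c * h s) (c * a).
Proof. by move=> hd; apply: (@is_deriveZ _ _ _ h). Qed.

Lemma jet2Z h t a b c : jet2 h t a b -> jet2 (fun s => c * h s) t (c * a) (c * b).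
Proof.
move=> [h1 [hd <- h1d]]; exists (fun s => c * h1 s).
split; [|by []|exact: is_deriveMl].
near=> s.
have hs : is_derive s 1 h (h1 s) by near: s.
exact: is_deriveMl.
Unshelve. all: by end_near. Qed.

Lemma is_derive_mul h k t a b : is_derive t 1 h a -> is_derive t 1 k b ->
  is_derive t 1 (fun s => h s * k s) (a * k t + h t * b).
Proof.
move=> hd kd; apply: (is_derive_eq (is_deriveM hd kd)).
by rewrite /GRing.scale /= addrC (mulrC (k t)).
Qed.

Lemma jet2M h k t a b c d : jet2 h t a b -> jet2 k t c d ->
  jet2 (fun s => h s * k s) t (a * k t + h t * c)
    (b * k t + 2 * (a * c) + h t * d).
Proof.
move=> jh jk; have ht := jet2_is_derive jh; have kt := jet2_is_derive jk.
move: jh jk => [h1 [hd h1t h1d]] [k1 [kd k1t k1d]].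
exists (fun s => h1 s * k s + h s * k1 s); split.
- near=> s.
  have hs : is_derive s 1 h (h1 s) by near: s.
  have ks : is_derive s 1 k (k1 s) by near: s.
  exact: is_derive_mul.
- by rewrite h1t k1t.
- apply: (is_derive_eq (is_deriveD (is_derive_mul h1d kt) (is_derive_mul ht k1d))).
  by rewrite h1t k1t; ring.
Unshelve. all: by end_near. Qed.

Lemma is_derive_lnc h t a : 0 < h t -> is_derive t 1 h a ->
  is_derive t 1 (fun s => ln (h s)) (a / h t).
Proof.
move=> ht hd; have l := is_derive1_ln ht.
by apply: (is_derive_eq (is_derive1_comp l hd)); rewrite mulrC.
Qed.

Lemma is_derive_cont h t a : is_derive t 1 h a -> {for t, continuous h}.
Proof.
by move=> hd; apply/differentiable_continuous/derivable1_diffP.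
Qed.

Lemma jet2_ln h t a b : 0 < h t -> jet2 h t a b ->
  jet2 (fun s => ln (h s)) t (a / h t) (b / h t - (a / h t) ^+ 2).
Proof.
move=> ht jh; have htd := jet2_is_derive jh.
have hpos : \forall s \near t, 0 < h s.
  by move: (is_derive_cont htd) => /(_ _ (lt_nbhsr ht)).
move: jh => [h1 [hd h1t h1d]].
exists (fun s => h1 s / h s); split; last first.
- have hi : is_derive t 1 (fun s => (h s)^-1) (- (h t) ^- 2 * a).
    apply: is_deriveV; by rewrite ?gt_eqF.
  apply: (is_derive_eq (is_derive_mul h1d hi)).
  rewrite h1t; field; exact: lt0r_neq0.
- by rewrite h1t.
near=> s.
have hs : is_derive s 1 h (h1 s) by near: s.
have ps : 0 < h s by near: s.
exact: is_derive_lnc.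
Unshelve. all: by end_near. Qed.

Lemma is_derive_affine c d t : is_derive t 1 (fun s => c * s + d) c.
Proof.
have hd : is_derive t 1 (fun s : R => c * s) (c * 1) by apply: is_deriveMl.
have k := @is_derive_cst R _ _ d t 1.
by apply: (is_derive_eq (is_deriveD hd k)); rewrite mulr1 addr0.
Qed.

Lemma is_derive_comp_affine h a c d t : is_derive (c * t + d) 1 h a ->
  is_derive t 1 (fun s => h (c * s + d)) (c * a).
Proof.
move=> hd.
by apply: (is_derive_eq (@is_derive1_comp _ h (fun s => c * s + d) t _ _ hd (is_derive_affine c d t))); rewrite mulrC.
Qed.

Lemma jet2_affine h t a b c d : jet2 h (c * t + d) a b ->
  jet2 (fun s => h (c * s + d)) t (c * a) (c ^+ 2 * b).
Proof.
move=> [h1 [hd <- h1d]]; exists (fun s => c * h1 (c * s + d)); split; [|by []|].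
- have hd' : \forall s \near t, is_derive (c * s + d) 1 h (h1 (c * s + d)).
    exact: (is_derive_cont (is_derive_affine c d t)) _ hd.
  near=> s; apply: is_derive_comp_affine; by near: s.
- rewrite expr2 -mulrA; apply: is_deriveMl; exact: is_derive_comp_affine.
Unshelve. all: by end_near. Qed.

Lemma is_derive_gt0_near h t a : is_derive t 1 h a -> 0 < a ->
  \forall s \near t, t < s -> h t < h s.
Proof.
move=> [hd1 hd2] a0.
move: hd1; rewrite /derivable => /cvg_ex[l hl].
have la : l = a by rewrite -hd2 /derive; apply/esym/cvg_lim.
rewrite la in hl.
have /nbhs_ballP[e /= e0 He] :
    \forall x \near (0 : R)^', 0 < x^-1 *: (h (x *: 1 + t) - h t).
  exact: (hl _ (lt_nbhsr a0)).
apply/nbhs_ballP; exists e => //= s; rewrite /ball /= => ts st.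
have := He (s - t); rewrite /ball /= sub0r normrN distrC => /(_ ts).
rewrite subr_eq0 gt_eqF // => /(_ isT).
rewrite /GRing.scale /= mulr1 subrK.
by rewrite pmulr_rgt0 ?invr_gt0 subr_gt0.
Qed.

Lemma is_derive_locmax_le0 h t a : is_derive t 1 h a ->
  (\forall s \near t, h s <= h t) -> a <= 0.
Proof.
move=> hd hmax; rewrite leNgt; apply/negP => /(is_derive_gt0_near hd) hgt.
have [e /= e0 He] : \forall s \near t, h s <= h t /\ (t < s -> h t < h s).
  by near=> s; split; near: s.
have [|] := He (t + e / 2).
  by rewrite /ball /= opprD addNKr normrN gtr0_norm; lra.
have te : t < t + e / 2 by lra.
by move=> hle /(_ te); lra.
Unshelve. all: by end_near. Qed.

Lemma is_derive_locmax h t a : is_derive t 1 h a ->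
  (\forall s \near t, h s <= h t) -> a = 0.
Proof.
move=> hd hmax; apply/eqP; rewrite eq_le (is_derive_locmax_le0 hd hmax) /=.
have tt : -1 * t + 2 * t = t by ring.
have hd' : is_derive (-1 * t + 2 * t) 1 h a by rewrite tt.
have := is_derive_locmax_le0 (is_derive_comp_affine hd').
rewrite tt mulN1r oppr_le0; apply.
have ct : (fun s => -1 * s + 2 * t) @ t --> t.
  rewrite -[X in _ --> X]tt; exact: is_derive_cont (is_derive_affine _ _ _).
exact: (ct _ hmax).
Qed.

Lemma jet2_locmax h t a b : jet2 h t a b -> (\forall s \near t, h s <= h t) ->
  a = 0 /\ b <= 0.
Proof.
move=> jh hmax; have hd := jet2_is_derive jh.
have a0 := is_derive_locmax hd hmax.
move: jh => [h1 [h1near h1t h1d]].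
split=> //; rewrite leNgt; apply/negP => /(is_derive_gt0_near h1d) h1gt.
have [e /= e0 He] : \forall s \near t, [/\ is_derive (s : R) 1 h (h1 s), h s <= h t &
  (t < s -> h1 t < h1 s)] by near=> s; split; near: s.
pose u := t + e / 2.
have tu : t < u by rewrite /u; lra.
have Hu s : t <= s <= u -> ball t e s.
  by rewrite /ball /= /u => ?; rewrite distrC ger0_norm; lra.
have [||c] := @MVT R h h1 t u tu.
- by move=> x; rewrite in_itv/= => xx; case: (He x) => //; apply: Hu; lra.
- apply: derivable_within_continuous => x; rewrite in_itv/= => xx.
  by case: (He x) => //; apply: Hu; lra.
rewrite in_itv/= => /andP[tc cu] hh.
have [|_ _ /(_ tc) hc] := He c; first by apply: Hu; lra.
have [|_ hut _] := He u; first by apply: Hu; lra.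
have : 0 < h1 c * (u - t) by rewrite mulr_gt0; lra.
by rewrite -hh; lra.
Unshelve. all: by end_near. Qed.

Lemma jet2_derive1 h t a b : jet2 h t a b ->
  derive1 h t = a /\ is_derive t 1 (derive1 h) b.
Proof.
move=> jh; have [_ ha] := jet2_is_derive jh; split; first by rewrite derive1E.
case: jh => h1 [hd _ h1d].
apply: near_eq_is_derive h1d; near=> s; rewrite derive1E.
have hs : is_derive s 1 h (h1 s) by near: s.
by case: hs.
Unshelve. all: by end_near. Qed.

Lemma jet2_derive1n h t a b : jet2 h t a b -> derive1n 2 h t = b.
Proof.
by case/jet2_derive1 => _ [_ hb]; rewrite derive1nS derive1n1 derive1E.
Qed.

End Jet.

(** * The one-dimensional comparison function *)

Section Model.
Context {R : realType}.
Implicit Types (h k : R -> R) (s t a b c d : R).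

Lemma primitive_gtN1 h : continuous h ->
  exists k, k 0 = 0 /\ forall t, -1 < t -> is_derive t 1 k (h t).
Proof.
move=> ch.
pose F x := (\int[@lebesgue_measure R]_(t in [set` `[(-1 : R), x]]) (h t))%R.
exists (fun x => F x - F 0); split; first by rewrite subrr.
move=> t t1.
have [||dF dFE] := @continuous_FTC1_closed R h (-1) t (t + 1) _ _ t1 (ch t).
- lra.
- apply: continuous_compact_integrable; first exact: segment_compact.
  exact: continuous_subspaceT.
have FD : is_derive t 1 F (h t).
  by apply: (DeriveDef dF); rewrite -derive1E.
have kD := @is_derive_cst R _ _ (- F 0) t 1.
by apply: (is_derive_eq (is_deriveD FD kD)); rewrite addr0.
Qed.

Lemma is_derive_growth h h1 c a b : a <= b ->
  (forall t, a <= t <= b -> is_derive t 1 h (h1 t)) ->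
  (forall t, a <= t <= b -> c <= h1 t) -> c * (b - a) <= h b - h a.
Proof.
move=> ab hd hc.
have [||t tab ->] := @MVT_segment R h h1 a b ab.
- by move=> x; rewrite in_itv/= => xx; apply: hd; lra.
- by apply: derivable_within_continuous => x; rewrite in_itv/= => /hd [].
- by apply: ler_wpM2r; [lra|exact: hc].
Qed.

Lemma model_function al be b : 0 < be -> 0 < b -> be * b < pi / 2 ->
  exists w w1 w2, [/\ w 0 = 0, forall t, -1 < t -> jet2 w t (w1 t) (w2 t),
    forall t, 0 <= t <= b -> 0 < w1 t,
    forall t, 0 <= t <= b -> w2 t - 2 * al * t * w1 t <= - (al + be ^+ 2) * w t &
    exists2 c, 0 < c & forall t, 0 <= t <= b -> c * t <= w t].
Proof.
move=> be0 b0 bb.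
pose E t := expR (al / 2 * (t * t)).
pose w1 t := E t * cos (be * t + 0).
pose w2 t := al * t * w1 t - be * (E t * sin (be * t + 0)).
have idD t := @is_derive_id R R^o t 1.
have ED t : is_derive t 1 E (al * t * E t).
  have qD : is_derive t 1 (fun s => al / 2 * (s * s)) (al * t).
    apply: (is_derive_eq (is_deriveMl (al / 2) (is_derive_mul (idD t) (idD t)))).
    by rewrite /=; field.
  by apply: (is_derive_eq (is_derive1_comp (is_derive_expR _) qD)); rewrite mulrC.
have cD t : is_derive t 1 (fun s => cos (be * s + 0)) (be * - sin (be * t + 0)).
  exact: is_derive_comp_affine (is_derive_cos _).
have sD t : is_derive t 1 (fun s => sin (be * s + 0)) (be * cos (be * t + 0)).
  exact: is_derive_comp_affine (is_derive_sin _).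
have w1D t : is_derive t 1 w1 (w2 t).
  by apply: (is_derive_eq (is_derive_mul (ED t) (cD t))); rewrite /w2 /w1; ring.
have cw1 : continuous w1 by move=> t; exact: is_derive_cont (w1D t).
have [w [w0 wD]] := primitive_gtN1 cw1.
have w1_gt0 t : 0 <= t <= b -> 0 < w1 t.
  move=> tb; rewrite mulr_gt0 ?expR_gt0 // cos_gt0_pihalf // addr0.
  have : be * t <= be * b by rewrite ler_pM2l //; lra.
  have : 0 <= be * t by rewrite mulr_ge0 //; lra.
  by have := pi_gt0 R; lra.
exists w, w1, w2; split=> //.
- move=> t t1; exists w1; split=> //; near=> s; apply: wD.
  by near: s; exact: lt_nbhsr.
- move=> t tb.
  (* [F s = 2 al s w1 s - w2 s - (al + be ^ 2) w s] vanishes at 0 and is nondecreasing. *)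
  pose F s := al * s * w1 s + be * (E s * sin (be * s + 0)) - (al + be ^+ 2) * w s.
  have FD s : 0 <= s <= t -> is_derive s 1 F (al ^+ 2 * s ^+ 2 * w1 s).
    move=> st.
    have ws : is_derive s 1 w (w1 s) by apply: wD; lra.
    have d1 := is_derive_mul (is_deriveMl al (idD s)) (w1D s).
    have d2 := is_deriveMl be (is_derive_mul (ED s) (sD s)).
    have d3 := is_deriveMl (al + be ^+ 2) ws.
    apply: (is_derive_eq (is_deriveB (is_deriveD d1 d2) d3)).
    by rewrite /w2 /w1 /=; ring.
  have := @is_derive_growth F _ 0 0 t _ FD; rewrite mul0r => /(_ _ _).
  have -> : F 0 = 0 by rewrite /F w0 !(mulr0, mul0r, addr0, sin0, subr0).
  move=> Ft; have : 0 <= F t - 0.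
    apply: Ft; first lra.
    move=> s st; apply: mulr_ge0; first by rewrite mulr_ge0 ?sqr_ge0.
    by apply: ltW; apply: w1_gt0; lra.
  by rewrite /F /w2; lra.
- have [||c] := @EVT_min R w1 0 b; [lra|exact: continuous_subspaceT|].
  rewrite in_itv/= => cb cmin; exists (w1 c); first exact: w1_gt0.
  move=> t tb; have := @is_derive_growth w w1 (w1 c) 0 t.
  rewrite w0 !subr0; apply; first lra.
    by move=> s st; apply: wD; lra.
  by move=> s st; apply: cmin; rewrite in_itv/=; lra.
Unshelve. all: by end_near. Qed.

End Model.

(** * Geodesics and distance in the space forms *)

Section Dot.
Context {R : realType} {m : nat}.
Implicit Types (x y z : 'rV[R]_m).

Lemma dotC x y : dot x y = dot y x.
Proof. by apply: eq_bigr => i _; rewrite mulrC. Qed.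

Lemma dotDl x y z : dot (x + y) z = dot x z + dot y z.
Proof. by rewrite /dot -big_split; apply: eq_bigr => i _; rewrite mxE mulrDl. Qed.

Lemma dotDr x y z : dot z (x + y) = dot z x + dot z y.
Proof. by rewrite !(dotC z) dotDl. Qed.

Lemma dotZl a x y : dot (a *: x) y = a * dot x y.
Proof. by rewrite /dot mulr_sumr; apply: eq_bigr => i _; rewrite mxE mulrA. Qed.

Lemma dotZr a x y : dot x (a *: y) = a * dot x y.
Proof. by rewrite dotC dotZl dotC. Qed.

Lemma dotNl x y : dot (- x) y = - dot x y.
Proof. by rewrite -scaleN1r dotZl mulN1r. Qed.

Lemma dotNr x y : dot x (- y) = - dot x y.
Proof. by rewrite dotC dotNl dotC. Qed.

Definition dotE := (dotDl, dotDr, dotZl, dotZr, dotNl, dotNr).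

Lemma dot_ge0 x : 0 <= dot x x.
Proof. by apply: sumr_ge0 => i _; rewrite -expr2 sqr_ge0. Qed.

Lemma dot_eq0 x : (dot x x == 0) = (x == 0).
Proof.
apply/idP/eqP => [|->]; last by rewrite /dot big1 // => i _; rewrite mxE mul0r.
rewrite psumr_eq0 => [/allP xx|i _]; last by rewrite -expr2 sqr_ge0.
apply/rowP => i; have := xx i; rewrite mem_index_enum mxE => /(_ isT).
by rewrite /= mulf_eq0 orbb => /eqP.
Qed.

Lemma norm2_sqr x : norm2 x ^+ 2 = dot x x.
Proof. by rewrite sqr_sqrtr // dot_ge0. Qed.

Lemma norm2_eq1 x : norm2 x = 1 <-> dot x x = 1.
Proof.
split=> [xx|xx]; first by rewrite -norm2_sqr xx expr1n.
by rewrite /norm2 xx sqrtr1.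
Qed.

Lemma norm2Z a x : norm2 (a *: x) = `|a| * norm2 x.
Proof.
by rewrite /norm2 dotZl dotZr mulrA -expr2 sqrtrM ?sqr_ge0 // sqrtr_sqr.
Qed.

Lemma norm2N x : norm2 (- x) = norm2 x.
Proof. by rewrite /norm2 dotNl dotNr opprK. Qed.

Lemma norm2_eq0 x : (norm2 x == 0) = (x == 0).
Proof. by rewrite -dot_eq0 -norm2_sqr expf_eq0. Qed.

Lemma dot_le_norm2 x y : norm2 x = 1 -> norm2 y = 1 -> -1 <= dot x y <= 1.
Proof.
move=> /norm2_eq1 x1 /norm2_eq1 y1.
have := dot_ge0 (x + y); have := dot_ge0 (x - y).
by rewrite !dotE x1 y1 (dotC y x); lra.
Qed.

Lemma dot_continuous (T : topologicalType) (F : set_system T) (FF : Filter F)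
    (h k : T -> 'rV[R]_m) x y :
  h @ F --> x -> k @ F --> y -> (fun t => dot (h t) (k t)) @ F --> dot x y.
Proof.
move=> hx ky; rewrite /dot.
apply: cvg_big => [|i _]; first exact: add_continuous.
apply: cvgM.
  exact: (cvg_comp h _ hx (@coord_continuous R 1 m 0 i x)).
exact: (cvg_comp k _ ky (@coord_continuous R 1 m 0 i y)).
Qed.

End Dot.

Section Curve.
Context {R : realType} {m : nat}.
Implicit Types (x v : 'rV[R]_m) (g : 'rV[R]_m -> R) (a b : R -> R) (t : R).

Lemma is_derive_curve g a b x v t (a1 b1 : R) :
  differentiable g (a t *: x + b t *: v) ->
  is_derive t 1 a a1 -> is_derive t 1 b b1 ->
  is_derive t 1 (fun s => g (a s *: x + b s *: v))
    (a1 * 'D_x g (a t *: x + b t *: v) + b1 * 'D_v g (a t *: x + b t *: v)).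
Proof.
move=> dg [da da1] [db db1].
pose c := fun s => a s *: x + b s *: v.
have da' : differentiable a t := proj1 (derivable1_diffP a t) da.
have db' : differentiable b t := proj1 (derivable1_diffP b t) db.
have dca : differentiable (fun s => a s *: x) t := differentiableZl x da'.
have dcb : differentiable (fun s => b s *: v) t := differentiableZl v db'.
have dc : differentiable c t := differentiableD dca dcb.
have dgc : differentiable (g \o c) t := differentiable_comp dc dg.
have ea : 'd a t 1 = a1 := etrans (esym (deriveE (1 : R) da')) da1.
have eb : 'd b t 1 = b1 := etrans (esym (deriveE (1 : R) db')) db1.
have xa : 'd (fun s => a s *: x) t 1 = a1 *: x by rewrite (diffZl x da') ea.
have vb : 'd (fun s => b s *: v) t 1 = b1 *: v by rewrite (diffZl v db') eb.
have s1 : 'd c t 1 = 'd (fun s => a s *: x) t 1 + 'd (fun s => b s *: v) t 1.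
  exact: (congr1 (fun F : R -> 'rV[R]_m => F 1) (diffD dca dcb)).
have c1 := etrans s1 (congr2 +%R xa vb).
apply: DeriveDef; first exact: (proj2 (derivable1_diffP _ _) dgc).
rewrite (deriveE (1 : R) dgc) (diff_comp dc dg).
rewrite [LHS]/= c1.
rewrite linearD.
rewrite !linearZ.
rewrite (deriveE x dg).
by rewrite (deriveE v dg).
Qed.

Lemma curve_continuous a b x v t : {for t, continuous a} ->
  {for t, continuous b} -> {for t, continuous (fun s => a s *: x + b s *: v)}.
Proof.
by move=> ca cb; apply: cvgD; apply: cvgZ => //; exact: cvg_cst.
Qed.

Lemma smooth_curve_jet (U : set 'rV[R]_m) g a b (a1 b1 : R -> R) (a2 b2 : R) x v t :
  open U -> smooth U g -> U (a t *: x + b t *: v) ->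
  (forall s : R, is_derive s 1 a (a1 s)) -> (forall s : R, is_derive s 1 b (b1 s)) ->
  is_derive t 1 a1 a2 -> is_derive t 1 b1 b2 ->
  exists p q, jet2 (fun s => g (a s *: x + b s *: v)) t p q.
Proof.
move=> oU sg Ut ad bd a1d b1d.
have [dg Dg] := sg 2.
have [dxg _] := Dg x; have [dvg _] := Dg v.
pose c := fun s => a s *: x + b s *: v.
have cc : {for t, continuous c}.
  by apply: curve_continuous; exact: is_derive_cont.
have nU : \forall s \near t, U (c s) by exact: (cc _ (open_nbhs_nbhs (conj oU Ut))).
eexists; eexists.
exists (fun s => a1 s * 'D_x g (c s) + b1 s * 'D_v g (c s)); split; last first.
- have dx := is_derive_curve (dxg _ Ut) (ad t) (bd t).
  have dv := is_derive_curve (dvg _ Ut) (ad t) (bd t).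
  exact: (is_deriveD (is_derive_mul a1d dx) (is_derive_mul b1d dv)).
- by [].
near=> s; apply: is_derive_curve => //; apply: dg; by near: s.
Unshelve. all: by end_near. Qed.

End Curve.

Section Acos.
Context {R : realType}.
Implicit Types (r c : R).

Lemma acos_le r c : 0 <= r <= pi -> -1 <= c <= 1 -> cos r <= c -> acos c <= r.
Proof.
move=> r0 c1 rc; rewrite leNgt; apply/negP => lt.
have ai : acos c \in `[0, pi] by rewrite in_itv/= acos_ge0 ?acos_lepi.
have ri : r \in `[0, pi] by rewrite in_itv.
have := ltr_cos ri ai.
by rewrite lt acosK ?in_itv //; lra.
Qed.

Lemma acos_cos_le r : acos (cos r) <= `|r|.
Proof.
have c1 : -1 <= cos r <= 1 by rewrite cos_geN1 cos_le1.
have [rpi|rpi] := leP `|r| pi; last exact: le_trans (acos_lepi c1) (ltW rpi).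
by apply: acos_le => //; rewrite ?normr_ge0 ?cos_norm.
Qed.

Lemma cvg_acos (T : Type) (F : set_system T) (FF : Filter F) (h : T -> R) c :
  -1 <= c <= 1 -> h @ F --> c -> (\forall t \near F, -1 <= h t <= 1) ->
  (fun t => acos (h t)) @ F --> acos c.
Proof.
move=> c1 hc h1.
have := @segment_can_ge_continuous R 0 pi cos acos (pi_ge0 R).
rewrite cospi cos0 => /(_ _ _)/subspace_continuousP ac.
have {}ac : acos @ within `[(-1 : R), 1] (nbhs c) --> acos c.
  apply: ac; rewrite /= ?in_itv //=; last exact: cosK.
  exact/continuous_subspaceT/continuous_cos.
move=> A /ac wA; have hwA : \forall t \near F, h t \in `[-1, 1] -> A (acos (h t)) := hc _ wA.
by apply: filterS2 hwA h1 => t hA ht; apply: hA; rewrite in_itv.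
Qed.

End Acos.

Section SpaceForm.
Context {R : realType} {M : space_form} {n : nat}.
Implicit Types (x y e : ambient R M n) (s t r : R).

Definition unit_tangent x e : Prop := [/\ points x, tangent x e & norm2 e = 1].

Definition velocity x e t : ambient R M n :=
  if M is Sphere then - sin t *: x + cos t *: e else e.

Definition base_coef t : R := if M is Sphere then cos t else 1.
Definition dir_coef t : R := if M is Sphere then sin t else t.

Lemma geodesicE x e t : norm2 e = 1 ->
  geodesic x e t = base_coef t *: x + dir_coef t *: e.
Proof.
rewrite /geodesic /base_coef /dir_coef; case: M x e => x e e1 /=.
  by rewrite scale1r.
by rewrite e1 mulr1 divr1.
Qed.

Lemma base_coef_derive : exists b1 b2 : R -> R, forall t : R,
  is_derive t 1 base_coef (b1 t) /\ is_derive t 1 b1 (b2 t).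
Proof.
rewrite /base_coef; case: M.
  exists (cst 0), (cst 0) => t; split; exact: is_derive_cst.
exists (fun t => - sin t), (fun t => - cos t) => t; split.
  exact: is_derive_cos.
exact: (is_deriveN (is_derive_sin t)).
Qed.

Lemma dir_coef_derive : exists b1 b2 : R -> R, forall t : R,
  is_derive t 1 dir_coef (b1 t) /\ is_derive t 1 b1 (b2 t).
Proof.
rewrite /dir_coef; case: M.
  exists (cst 1), (cst 0) => t; split; last exact: is_derive_cst.
  exact: (@is_derive_id R R^o).
exists cos, (fun t => - sin t) => t; split.
  exact: is_derive_sin.
exact: is_derive_cos.
Qed.

Lemma geodesic_continuous x e t : norm2 e = 1 -> {for t, continuous (geodesic x e)}.
Proof.
move=> e1; have -> : geodesic x e = fun s => base_coef s *: x + dir_coef s *: e.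
  by apply/funext => s; exact: geodesicE.
have [b1 [b2 bd]] := base_coef_derive; have [d1 [d2 dd]] := dir_coef_derive.
by apply: curve_continuous; [exact: is_derive_cont (bd t).1|exact: is_derive_cont (dd t).1].
Qed.

Lemma geodesic0 x e : norm2 e = 1 -> geodesic x e 0 = x.
Proof.
move=> e1; rewrite geodesicE // /base_coef /dir_coef.
by case: M x {e1} e => x e; rewrite ?cos0 ?sin0 scale1r scale0r addr0.
Qed.

Lemma geodesicZ x e r t : norm2 e = 1 -> 0 < r ->
  geodesic x (r *: e) t = geodesic x e (t * r).
Proof.
move=> e1 r0; rewrite (geodesicE _ _ e1) /geodesic /base_coef /dir_coef.
case: M x e e1 => x e e1; first by rewrite scalerA scale1r.
rewrite norm2Z e1 mulr1 gtr0_norm // scalerA divfK //; exact: lt0r_neq0.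
Qed.

Lemma unit_tangent_geodesic x e t : unit_tangent x e ->
  unit_tangent (geodesic x e t) (velocity x e t).
Proof.
move=> [px te e1]; rewrite geodesicE //.
move: px te e1; rewrite /unit_tangent /tangent /points /velocity /base_coef /dir_coef.
case: M x e => x e //= px te /norm2_eq1 e1.
have et : dot e x = 0 by rewrite dotC.
have cs := cos2Dsin2 t.
split; last rewrite norm2_eq1; rewrite /= !dotE px te e1 et.
- by rewrite -[RHS]cs; ring.
- by ring.
- by rewrite -[RHS]cs; ring.
Qed.

Lemma geodesicD x e s t : unit_tangent x e ->
  geodesic (geodesic x e t) (velocity x e t) s = geodesic x e (t + s).
Proof.
move=> ue; have [_ _ v1] := unit_tangent_geodesic t ue; have [_ _ e1] := ue.
rewrite !geodesicE // /velocity /base_coef /dir_coef.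
case: M x e {ue v1 e1} => x e.
  by rewrite !scale1r scalerDl addrA.
rewrite cosD sinD; apply/rowP => i; rewrite !mxE; ring.
Qed.

Lemma gdistC x y : gdist x y = gdist y x.
Proof.
rewrite /gdist; case: M x y => x y; last by rewrite dotC.
by rewrite -(opprB y x) norm2N.
Qed.

Lemma dot_points x y : M = Sphere -> points x -> points y -> -1 <= dot x y <= 1.
Proof.
by rewrite /points; case: M x y => //= x y _ xx yy; apply: dot_le_norm2; rewrite norm2_eq1.
Qed.

Lemma gdist_ge0 x y : points x -> points y -> 0 <= gdist x y.
Proof.
rewrite /gdist; move: (@dot_points x y); case: M x y => x y xy px py.
  exact: sqrtr_ge0.
by rewrite acos_ge0 // xy.
Qed.

Lemma gdist_geodesic x e s t : unit_tangent x e ->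
  gdist (geodesic x e s) (geodesic x e t) <= `|s - t|.
Proof.
move=> [px te e1]; rewrite !geodesicE //.
move: px te e1; rewrite /gdist /tangent /points /base_coef /dir_coef.
case: M x e => x e px te e1.
  have -> : 1 *: x + s *: e - (1 *: x + t *: e) = (s - t) *: e.
    by apply/rowP => i; rewrite !mxE; ring.
  by rewrite norm2Z e1 mulr1.
have -> : dot (cos s *: x + sin s *: e) (cos t *: x + sin t *: e) = cos (s - t).
  rewrite !dotE (dotC e x) te px cosB.
  by have /norm2_eq1 -> := e1; ring.
exact: acos_cos_le.
Qed.

Lemma cvg_gdist (T : topologicalType) (F : set_system T) (FF : Filter F)
    (h k : T -> ambient R M n) x y :
  points x -> points y -> h @ F --> x -> k @ F --> y ->
  (\forall p \near F, points (h p) /\ points (k p)) ->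
  (fun p => gdist (h p) (k p)) @ F --> gdist x y.
Proof.
rewrite /gdist; move: h k x y (@dot_points); case: M => h k x y xy px py hx ky hk.
  have hkx : (fun p => h p - k p) @ F --> x - y by exact: cvgB.
  have := dot_continuous FF hkx hkx.
  by move=> /(cvg_comp _ _)/(_ (@sqrt_continuous R _)).
apply: cvg_acos; [exact: xy|exact: dot_continuous|].
by apply: filterS hk => p [? ?]; exact: xy.
Qed.

End SpaceForm.

Arguments base_coef {R} M t.
Arguments dir_coef {R} M t.

Section Frames.
Context {R : realType}.

Lemma exists_unit_normal m k (v : nat -> 'rV[R]_m) : (k < m)%N ->
  exists u, norm2 u = 1 /\ forall i, (i < k)%N -> dot (v i) u = 0.
Proof.
move=> km; pose A : 'M[R]_(k, m) := \matrix_(i < k) v i.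
have : kermx A^T != 0.
  rewrite -mxrank_eq0 mxrank_ker -lt0n subn_gt0.
  by apply: leq_ltn_trans km; exact: rank_leq_col.
move=> /rowV0Pn[u /sub_kermxP uA u0].
exists ((norm2 u)^-1 *: u); split.
  rewrite norm2Z ger0_norm ?invr_ge0 ?sqrtr_ge0 //.
  by rewrite mulVf // norm2_eq0.
move=> i ik; rewrite dotZr; suff -> : dot (v i) u = 0 by rewrite mulr0.
have /matrixP/(_ 0 (Ordinal ik)) := uA; rewrite !mxE => <-.
by apply: eq_bigr => j _; rewrite !mxE mulrC.
Qed.

Definition orthonormal m k (v : nat -> 'rV[R]_m) :=
  forall i j, (i < k)%N -> (j < k)%N -> dot (v i) (v j) = (i == j)%:R.

Lemma orthonormal_extend m k (v : nat -> 'rV[R]_m) : (k <= m)%N ->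
  orthonormal k v ->
  exists w, (forall i, (i < k)%N -> w i = v i) /\ orthonormal m w.
Proof.
move=> km; move: {2}(m - k)%N (erefl (m - k)%N) => d.
elim: d k v km => [|d IH] k v km dE ov.
  have mk : (m <= k)%N by rewrite -subn_eq0 dE.
  by exists v; split=> // i j im jm; apply: ov; exact: leq_trans mk.
have {}km : (k < m)%N by rewrite -subn_gt0 dE.
have [u [u1 vu]] := exists_unit_normal v km.
pose v' i := if i == k then u else v i.
have [||w [wv ow]] := IH k.+1 v' km.
- by rewrite subnS dE.
- move=> i j; rewrite !ltnS /v' (leq_eqVlt i) (leq_eqVlt j).
  have [->|ik] := eqVneq i k; have [->|jk] := eqVneq j k => //= ik' jk'.
  + exact/norm2_eq1.
  + by rewrite dotC vu // eq_sym (negbTE jk).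
  + by rewrite vu // (negbTE ik).
  + exact: ov.
exists w; split=> // i ik; rewrite wv ?(ltnW ik) // /v'; last exact: ltnW.
by case: eqP ik => // ->; rewrite ltnn.
Qed.

Context {M : space_form} {n : nat}.
Implicit Types (x y e v : ambient R M n) (s t r d : R).

Lemma orthonormal_frame_exists x e : (0 < n)%N -> unit_tangent x e ->
  exists i0 (E : 'I_n -> ambient R M n), orthonormal_frame x E /\ E i0 = e.
Proof.
move=> n0; rewrite /orthonormal_frame /unit_tangent /points /tangent.
case: M x e => x e [/= px te /norm2_eq1 e1]; exists (Ordinal n0).
  have [|w [we ow]] := @orthonormal_extend _ 1 (fun=> e) n0.
    by case=> // -[].
  exists (fun i => w i); rewrite /= we //; split=> //; split=> // i j.
  by rewrite ow.
pose v i := if i is 0%N then x else e.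
have [||w [wv ow]] := @orthonormal_extend n.+1 2 v.
- by [].
- by case=> [|[|i]] [|[|j]] //= _ _; rewrite // dotC.
exists (fun i => w i.+1); rewrite /= wv //; split=> //; split=> i.
  have w0 : w 0%N = x by exact: (wv 0%N isT).
  by rewrite -w0 ow // ltnS ltn_ord.
by move=> j; rewrite ow // ltnS ltn_ord.
Qed.

Lemma parallel_frame x e d : (0 < n)%N -> unit_tangent x e ->
  exists i0 (E E' : 'I_n -> ambient R M n),
    [/\ orthonormal_frame x E, orthonormal_frame (geodesic x e d) E',
        E i0 = e, E' i0 = velocity x e d & forall i, i != i0 -> E' i = E i].
Proof.
move=> n0 ue; have [i0 [E [oE Ee]]] := orthonormal_frame_exists n0 ue.
exists i0, E, (fun i => if i == i0 then velocity x e d else E i).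
split=> //; [|by rewrite eqxx|by move=> i /negbTE->].
have [_ tv /norm2_eq1 v1] := unit_tangent_geodesic d ue.
have Ee0 i : i != i0 -> dot (E i) e = 0.
  by move=> ii; rewrite -Ee oE.2 (negbTE ii).
have [_ _ e1] := ue.
have Ev i : i != i0 -> dot (E i) (velocity x e d) = 0.
  move=> ii; have := oE.1 i; have := Ee0 i ii; rewrite /velocity /tangent.
  case: M x e {n0 ue oE Ee tv v1 Ee0 e1} E => x e E //= Eie xEi.
  by rewrite !dotE Eie (dotC (E i)) xEi; ring.
split=> [i|i j].
  case: ifPn => [_|ii]; first exact: tv.
  have := oE.1 i; have := Ee0 i ii; rewrite geodesicE // /base_coef /dir_coef /tangent.
  case: M x e {n0 ue oE Ee tv v1 Ee0 e1 Ev} E => x e E //= Eie xEi.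
  by rewrite !dotE xEi (dotC e) Eie; ring.
case: (altP (i =P i0)) => [->|ii]; case: (altP (j =P i0)) => [->|jj].
- by rewrite eqxx.
- by rewrite dotC Ev // eq_sym (negbTE jj).
- by rewrite Ev // (negbTE ii).
- exact: oE.2.
Qed.

Lemma geodesic_chord_normal x e v d : norm2 e = 1 -> tangent x v ->
  dot e v = 0 -> dot (x - geodesic x e d) v = 0.
Proof.
move=> e1; rewrite geodesicE // /tangent /base_coef /dir_coef.
by case: M x e v e1 => x e v _ /= xv ev; rewrite !dotE ev ?xv; ring.
Qed.

Lemma minimal_geodesic x y : (0 < n)%N -> points x -> points y -> x != y ->
  0 < gdist x y /\ exists2 e, unit_tangent x e & y = geodesic x e (gdist x y).
Proof.
move=> n0; rewrite /points /gdist /unit_tangent /tangent /geodesic.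
case: M x y => x y /= px py xy.
  have d0 : 0 < norm2 (x - y).
    by rewrite lt_neqAle sqrtr_ge0 eq_sym norm2_eq0 subr_eq0 xy.
  split=> //; exists ((norm2 (x - y))^-1 *: (y - x)).
    split=> //; rewrite norm2Z -(opprB x y) norm2N.
    by rewrite gtr0_norm ?invr_gt0 // mulVf // gt_eqF.
  by rewrite scalerA divff ?gt_eqF // scale1r addrC subrK.
have c1 : -1 <= dot x y <= 1 by apply: dot_le_norm2; rewrite norm2_eq1.
have c1' : dot x y != 1.
  apply: contra xy => /eqP c; rewrite -subr_eq0 -dot_eq0 !dotE px py (dotC y) c.
  by apply/eqP; ring.
have d0 : 0 < acos (dot x y) by apply: acos_gt0; lra.
have cd : cos (acos (dot x y)) = dot x y by rewrite acosK ?in_itv.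
split=> //; set d := acos _ in d0 cd *.
have [cN|cN] := eqVneq (dot x y) (-1).
  have [u [u1 xu]] := @exists_unit_normal n.+1 1 (fun=> x) n0.
  exists u; first by split=> //; exact: (xu 0%N).
  have dpi : d = pi by rewrite /d cN acosN1.
  rewrite u1 mulr1 divr1 dpi cospi sinpi scale0r addr0 scaleN1r.
  apply/eqP; rewrite -subr_eq0 opprK -dot_eq0 !dotE px py (dotC y) cN.
  by apply/eqP; ring.
have s0 : 0 < sin d.
  by apply: sin_gt0_pi; rewrite d0 acos_ltpi //; lra.
have u1 : norm2 ((sin d)^-1 *: (y - cos d *: x)) = 1.
  apply/norm2_eq1; rewrite !dotE px py (dotC y) cd.
  transitivity ((sin d) ^- 2 * (1 - dot x y ^+ 2)).
    by field; exact: lt0r_neq0.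
  by rewrite -cd -sin2cos2 mulVf // expf_eq0 gt_eqF.
exists ((sin d)^-1 *: (y - cos d *: x)).
  by split=> //=; rewrite !dotE px cd; ring.
rewrite u1 mulr1 divr1 scalerA divff ?gt_eqF // scale1r.
by rewrite addrC subrK.
Qed.

Lemma gdist_parallel x y v t : unit_tangent x v -> unit_tangent y v ->
  gdist (geodesic x v t) (geodesic y v t) <= gdist x y.
Proof.
move=> [px tx v1] [py ty _]; rewrite !geodesicE //.
move: px tx py ty (@dot_points R M n x y).
rewrite /points /tangent /gdist /base_coef /dir_coef.
case: M x y v v1 => x y v v1 /= px tx py ty xy.
  by rewrite !scale1r opprD addrACA subrr addr0.
have c1 := xy erefl px py.
have -> : dot (cos t *: x + sin t *: v) (cos t *: y + sin t *: v) =
    cos t ^+ 2 * dot x y + sin t ^+ 2.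
  have /norm2_eq1 v1' := v1.
  by rewrite !dotE (dotC v y) tx ty v1'; ring.
have cs := cos2Dsin2 t; have s0 := sqr_ge0 (sin t); have c0 := sqr_ge0 (cos t).
apply: acos_le; rewrite ?acos_ge0 ?acos_lepi ?acosK ?in_itv //=; nra.
Qed.

Lemma gdist_normal_barrier x y v : points x -> unit_tangent y v ->
  dot (x - y) v = 0 -> 0 < gdist x y ->
  exists B : R -> R, [/\ B 0 = gdist x y, is_derive (0 : R) 1 B 0 &
    forall t, gdist x (geodesic y v t) <= B t].
Proof.
move=> px [py ty v1].
have -> : geodesic y v = fun t => base_coef M t *: y + dir_coef M t *: v.
  by apply/funext => t; exact: geodesicE.
move: px py ty (@dot_points R M n x y).
rewrite /points /tangent /gdist /base_coef /dir_coef.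
case: M x y v v1 => x y v v1 /= px py ty xy; rewrite dotDl dotNl.
  set d := norm2 (x - y) => xyv d0.
  exists (fun t => d + (2 * d)^-1 * (t * t)); split.
  - by rewrite !mulr0 addr0.
  - have idD := @is_derive_id R R^o 0 1.
    have qD : is_derive (0 : R) 1 (fun t => (2 * d)^-1 * (t * t)) 0.
      apply: (is_derive_eq (is_deriveMl (2 * d)^-1 (is_derive_mul idD idD))).
      by rewrite /=; ring.
    have kD := @is_derive_cst R _ _ d (0 : R) 1.
    by apply: (is_derive_eq (is_deriveD kD qD)); rewrite addr0.
  - move=> t; have B0 : 0 <= d + (2 * d)^-1 * (t * t).
      by rewrite addr_ge0 ?(ltW d0) // mulr_ge0 -?expr2 ?sqr_ge0 // invr_ge0; lra.
    rewrite -(ler_pXn2r (n := 2)) ?nnegrE ?sqrtr_ge0 // norm2_sqr scale1r.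
    have dd : dot x x - 2 * dot x y + dot y y = d ^+ 2.
      by rewrite norm2_sqr !dotE (dotC y x); ring.
    have /norm2_eq1 vv := v1.
    have -> : dot (x - (y + t *: v)) (x - (y + t *: v)) = d ^+ 2 + t ^+ 2.
      rewrite -dd !dotE (dotC y x) (dotC v x) (dotC v y) vv.
      have -> : dot x v = dot y v by lra.
      ring.
    have -> : (d + (2 * d)^-1 * (t * t)) ^+ 2 =
        d ^+ 2 + t ^+ 2 + ((2 * d)^-1 * (t * t)) ^+ 2.
      by field; exact: lt0r_neq0.
    by rewrite lerDl sqr_ge0.
rewrite ty subr0 => xv d0; have c1 := xy erefl px py.
have gE t : dot x (cos t *: y + sin t *: v) = cos t * dot x y.
  by rewrite !dotE xv; ring.
have ct1 t := cos_geN1 t; have ct2 t := cos_le1 t.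
have c1t t : -1 <= cos t * dot x y <= 1 by have := ct1 t; have := ct2 t; nra.
(* For antipodal points the distance is not differentiable, but it is at most [pi]. *)
have [cN|cN] := eqVneq (dot x y) (-1).
  exists (cst pi); split; first by rewrite cN acosN1.
    exact: is_derive_cst.
  by move=> t; rewrite gE acos_lepi.
exists (fun t => acos (dot x y * cos t)); split.
- by rewrite cos0 mulr1.
- have c2 : dot x y != 1 by apply: contraTneq d0 => ->; rewrite acos1 ltxx.
  have aD : is_derive (dot x y * cos 0) 1 (@acos R)
      (- (Num.sqrt (1 - (dot x y * cos 0) ^+ 2))^-1).
    by apply: is_derive1_acos; rewrite cos0 mulr1; lra.
  have cD := is_deriveMl (dot x y) (is_derive_cos 0).
  apply: (is_derive_eq (@is_derive1_comp _ acos (fun t => dot x y * cos t) 0 _ _ aD cD)).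
  by rewrite sin0 oppr0 !mulr0.
- by move=> t; rewrite gE mulrC.
Qed.

End Frames.

(** * Equations along geodesics *)

Section Domain.
Context {R : realType} {M : space_form} {n : nat}.
Variable Om : set (ambient R M n).
Hypothesis Om_domain : domain Om.
Implicit Types (x y e v : ambient R M n) (s t r d : R).
Implicit Types u : ambient R M n -> R.

Lemma domain_points x : Om x -> points x.
Proof. by case: Om_domain => -[U _ ->] _ _ []. Qed.

Lemma near_geodesic_domain x e t : unit_tangent x e -> Om (geodesic x e t) ->
  \forall s \near t, Om (geodesic x e s).
Proof.
case: Om_domain => -[U oU ->] _ _ ue [Ut _]; have [_ _ e1] := ue.
have nU : \forall s \near t, U (geodesic x e s).
  exact: (@geodesic_continuous R M n x e t e1 _ (open_nbhs_nbhs (conj oU Ut))).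
near=> s; split; first by near: s.
by have [] := unit_tangent_geodesic s ue.
Unshelve. all: by end_near. Qed.

Lemma smooth_geodesic_jet u x e t : smooth_in Om u -> unit_tangent x e ->
  Om (geodesic x e t) ->
  exists p q, jet2 (fun s => u (geodesic x e s)) t p q.
Proof.
move=> [U [g [oU OU sg gu]]] ue Ot; have [_ _ e1] := ue.
have [b1 [b2 bd]] := @base_coef_derive R M; have [d1 [d2 dd]] := @dir_coef_derive R M.
have gE s : geodesic x e s = base_coef M s *: x + dir_coef M s *: e.
  exact: geodesicE.
have [|p [q jg]] := @smooth_curve_jet _ _ U g (base_coef M) (dir_coef M)
  b1 d1 (b2 t) (d2 t) x e t oU sg _ (fun s => (bd s).1) (fun s => (dd s).1) (bd t).2 (dd t).2.
  by rewrite -gE; exact: OU.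
exists p, q; apply: jet2_near_eq jg.
near=> s; rewrite -gE; apply: gu; near: s.
exact: near_geodesic_domain.
Unshelve. all: by end_near. Qed.

Lemma hess_jet u x e p q : jet2 (fun s => u (geodesic x e s)) 0 p q ->
  hess u x e = q.
Proof. exact: jet2_derive1n. Qed.

Lemma smooth_up_to_boundary_in u : smooth_up_to_boundary Om u -> smooth_in Om u.
Proof.
move=> [U [g [oU cU sg gu]]]; exists U, g; split=> //.
exact: subset_trans (@subset_closure _ _) cU.
Qed.

Lemma frame_unit_tangent x (E : 'I_n -> ambient R M n) i :
  points x -> orthonormal_frame x E -> unit_tangent x (E i).
Proof.
by move=> px [tE oE]; split=> //; apply/norm2_eq1; rewrite oE eqxx.
Qed.

Variables (V f f2 : ambient R M n -> R) (lam1 lam2 : R).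
Hypothesis f_eigen : eigenfunction Om V lam1 f.
Hypothesis f_gt0 : forall x, Om x -> 0 < f x.
Hypothesis f2_eigen : eigenfunction Om V lam2 f2.
Hypothesis ratio_smooth : smooth_in Om (fun x => f2 x / f x).

Lemma log_geodesic_jet x e t : unit_tangent x e -> Om (geodesic x e t) ->
  exists q Q, jet2 (fun s => f (geodesic x e s)) t (q * f (geodesic x e t))
                (Q * f (geodesic x e t)) /\
    jet2 (fun s => ln (f (geodesic x e s))) t q (Q - q ^+ 2).
Proof.
move=> ue Ot; have [[sf _] _ _ _] := f_eigen.
have [a [b jf]] := smooth_geodesic_jet sf ue Ot.
have f0 := f_gt0 Ot.
exists (a / f (geodesic x e t)), (b / f (geodesic x e t)); split.
  by rewrite !divfK ?gt_eqF.
exact: (@jet2_ln _ (fun s => f (geodesic x e s)) t a b).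
Qed.

Lemma frame_equations x (E : 'I_n -> ambient R M n) :
  Om x -> orthonormal_frame x E ->
  exists p P q Q : 'I_n -> R,
    [/\ forall i, jet2 (fun s => f2 (geodesic x (E i) s) / f (geodesic x (E i) s))
                    0 (p i) (P i),
      forall i, jet2 (fun s => ln (f (geodesic x (E i) s))) 0 (q i) (Q i - q i ^+ 2),
      \sum_(i < n) P i + 2 * \sum_(i < n) p i * q i = - (lam2 - lam1) * (f2 x / f x) &
      \sum_(i < n) Q i = V x - lam1].
Proof.
move=> Ox oE; have px := domain_points Ox.
have uE i : unit_tangent x (E i) by exact: frame_unit_tangent.
have E0 i : geodesic x (E i) 0 = x by have [_ _ e1] := uE i; exact: geodesic0.
have OE i : Om (geodesic x (E i) 0) by rewrite E0.
have jv i : {pq : R * R | jet2 (fun s => f2 (geodesic x (E i) s) / f (geodesic x (E i) s))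
    0 pq.1 pq.2}.
  apply: cid; have [a [b jab]] := smooth_geodesic_jet ratio_smooth (uE i) (OE i).
  by exists (a, b).
have jf i : {pq : R * R | jet2 (fun s => f (geodesic x (E i) s)) 0
    (pq.1 * f x) (pq.2 * f x) /\
    jet2 (fun s => ln (f (geodesic x (E i) s))) 0 pq.1 (pq.2 - pq.1 ^+ 2)}.
  apply: cid; have [a [b]] := log_geodesic_jet (uE i) (OE i).
  by rewrite E0 => jab; exists (a, b).
have f0 := f_gt0 Ox; have f0' : f x != 0 by rewrite gt_eqF.
pose p i := (projT1 (jv i)).1; pose P i := (projT1 (jv i)).2.
pose q i := (projT1 (jf i)).1; pose Q i := (projT1 (jf i)).2.
have jvE i := projT2 (jv i); have jfE i := projT2 (jf i).
exists p, P, q, Q.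
have [_ _ _ /(_ x Ox)[lapf /(_ E oE) lf ef]] := f_eigen.
have [_ _ _ /(_ x Ox)[lapf2 /(_ E oE) lf2 ef2]] := f2_eigen.
have hf i : hess f x (E i) = Q i * f x by apply: hess_jet (jfE i).1.
(* Product rule for [f2 = (f2 / f) f]. *)
have hf2 i : hess f2 x (E i) =
    f x * (P i + 2 * (p i * q i)) + f2 x / f x * (Q i * f x).
  have jm := jet2M (jvE i) (jfE i).1.
  have : jet2 (fun s => f2 (geodesic x (E i) s)) 0 (p i * f x + f2 x / f x * (q i * f x))
      (P i * f x + 2 * (p i * (q i * f x)) + f2 x / f x * (Q i * f x)).
    rewrite /= E0 in jm; apply: jet2_near_eq jm.
    near=> s; rewrite divfK // gt_eqF // f_gt0 //; near: s.
    exact: near_geodesic_domain.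
  by move=> /hess_jet ->; ring.
have sQ : \sum_(i < n) Q i = V x - lam1.
  have : lapf = (\sum_(i < n) Q i) * f x.
    by rewrite lf mulr_suml; apply: eq_bigr => i _; rewrite hf.
  by move=> lE; apply: (mulIf f0'); rewrite -lE mulrBl -ef; ring.
split=> //; [by move=> i; exact: (jfE i).2|].
have l2 : lapf2 = f x * (\sum_(i < n) P i + 2 * \sum_(i < n) p i * q i) +
    f2 x * (V x - lam1).
  rewrite lf2 -sQ mulr_sumr -big_split /= !mulr_sumr -big_split /=.
  by apply: eq_bigr => i _; rewrite hf2 /=; field.
apply: (mulfI f0'); apply: (addIr (f2 x * (V x - lam1))); rewrite -l2.
have -> : lapf2 = (V x - lam2) * f2 x by rewrite mulrBl -ef2; ring.
by field.
Unshelve. all: by end_near. Qed.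

Variable al : R.
Hypothesis al_le : forall x e, Om x -> unit_tangent x e ->
  al <= hess (fun y => - ln (f y)) x e.

Lemma log_slope_le x e d a b c1 c2 : 0 <= d -> unit_tangent x e ->
  (forall t, 0 <= t <= d -> Om (geodesic x e t)) ->
  jet2 (fun s => ln (f (geodesic x e s))) 0 a c1 ->
  jet2 (fun s => ln (f (geodesic (geodesic x e d) (velocity x e d) s))) 0 b c2 ->
  b - a <= - al * d.
Proof.
move=> d0 ue Oe ja jb.
pose g s := ln (f (geodesic x e s)).
have shift t : (fun s => ln (f (geodesic (geodesic x e t) (velocity x e t) s))) =
    (fun s => g (1 * s + t)).
  by apply/funext => s; rewrite geodesicD // mul1r addrC.
have jg t : 0 <= t <= d -> exists c0 c, jet2 g t c0 c /\ al <= - c.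
  move=> td; have [q [Q [_ jq]]] := log_geodesic_jet ue (Oe t td).
  exists q, (Q - q ^+ 2); split=> //.
  have := al_le (Oe t td) (unit_tangent_geodesic t ue); congr (_ <= _).
  apply: (@hess_jet _ _ _ (-1 * (1 * q))).
  have jq' : jet2 g (1 * 0 + t) q (Q - q ^+ 2) by rewrite mulr0 add0r.
  apply: jet2_eq (jet2Z (-1) (jet2_affine jq')) => [s||] //.
    by rewrite mulN1r -(congr1 (fun F : R -> R => F s) (shift t)).
  by rewrite expr1n mul1r mulN1r.
have gd : derive1 g d = b.
  have [|c0 [c [jc _]]] := jg d; first by rewrite lexx d0.
  have jc' : jet2 g (1 * 0 + d) c0 c by rewrite mulr0 add0r.
  have [<- _] := jet2_derive1 jb; rewrite shift.
  have [-> _] := jet2_derive1 (jet2_affine jc'); rewrite mul1r.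
  by have [] := jet2_derive1 jc.
have g0 : derive1 g 0 = a by have [] := jet2_derive1 ja.
have := @is_derive_growth R (fun s => -1 * derive1 g s)
  (fun s => -1 * 'D_1 (derive1 g) s) al 0 d d0.
rewrite gd g0 subr0 => /(_ _ _) growth.
have {growth} : al * d <= -1 * b - -1 * a.
  apply: growth => t td; have [c0 [c [jc alc]]] := jg t td.
    apply: is_deriveMl; have [_ hc] := jet2_derive1 jc.
    by case: (hc) => h1 h2; apply: (DeriveDef h1).
  by have [_ [_ ->]] := jet2_derive1 jc; rewrite mulN1r.
by lra.
Qed.

End Domain.

(** * The two-point maximum principle *)

Section TwoPoint.
Context {R : realType} {M : space_form} {n : nat}.
Variable Om : set (ambient R M n).
Implicit Types (x y e : ambient R M n) (s t r d : R).
Variables (v g : ambient R M n -> R) (w w1 w2 : R -> R) (b C eps : R).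

(* The term in [eps] penalizes the boundary, where [g = ln f] tends to [-oo]. *)
Definition two_point x y : R :=
  v y + -1 * v x + (- (2 * C)) * w (gdist x y / 2) + eps * (g x + g y).

Hypothesis Om_points : forall x, Om x -> points x.
Hypothesis w_jet : forall t, -1 < t -> jet2 w t (w1 t) (w2 t).
Hypothesis w1_gt0 : forall t, 0 <= t <= b -> 0 < w1 t.
Hypothesis C_ge0 : 0 <= C.

Lemma model_nondecreasing r s : 0 <= r -> r <= s -> s <= b -> w r <= w s.
Proof.
move=> r0 rs sb; rewrite -subr_ge0 -(mul0r (s - r)).
apply: (is_derive_growth rs (h1 := w1)).
- by move=> t tt; apply: jet2_is_derive; apply: w_jet; lra.
- by move=> t tt; apply/ltW/w1_gt0; lra.
Qed.

Section Variation.
Variables (x y : ambient R M n).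
Hypothesis Zmax : forall x' y', Om x' -> Om y' -> two_point x' y' <= two_point x y.
Hypothesis d_lt : gdist x y / 2 < b.
Variables (X Y : R -> ambient R M n) (L : R -> R).
Hypotheses (X0 : X 0 = x) (Y0 : Y 0 = y) (L0 : L 0 = gdist x y / 2).
Hypothesis XOm : \forall t \near (0 : R), Om (X t).
Hypothesis YOm : \forall t \near (0 : R), Om (Y t).
Hypothesis L_ge : \forall t \near (0 : R), gdist (X t) (Y t) / 2 <= L t.

Lemma variation_locmax : {for 0, continuous L} ->
  \forall t \near (0 : R),
    v (Y t) + -1 * v (X t) + (- (2 * C)) * w (L t) + eps * (g (X t) + g (Y t)) <=
    v (Y 0) + -1 * v (X 0) + (- (2 * C)) * w (L 0) + eps * (g (X 0) + g (Y 0)).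
Proof.
move=> cL; have Lb : \forall t \near (0 : R), L t < b.
  have Lb0 : L 0 < b by rewrite L0.
  exact: (cL _ (lt_nbhsl Lb0)).
near=> t.
have Xt : Om (X t) by near: t.
have Yt : Om (Y t) by near: t.
have Lt : gdist (X t) (Y t) / 2 <= L t by near: t.
have Ltb : L t < b by near: t.
have := Zmax Xt Yt; rewrite /two_point X0 Y0 L0; apply: le_trans.
rewrite lerD2r lerD2l ler_wnM2l ?oppr_le0 ?mulr_ge0 //.
have := gdist_ge0 (Om_points Xt) (Om_points Yt).
by move=> d0; apply: model_nondecreasing => //; lra.
Unshelve. all: by end_near. Qed.

Lemma first_variation pX pY qX qY l : -1 < gdist x y / 2 ->
  is_derive (0 : R) 1 (fun t => v (X t)) pX -> is_derive (0 : R) 1 (fun t => v (Y t)) pY ->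
  is_derive (0 : R) 1 (fun t => g (X t)) qX -> is_derive (0 : R) 1 (fun t => g (Y t)) qY ->
  is_derive (0 : R) 1 L l ->
  pY - pX - 2 * C * (w1 (gdist x y / 2) * l) + eps * (qX + qY) = 0.
Proof.
move=> d1 vX vY gX gY lD; have := variation_locmax (is_derive_cont lD).
have wL : is_derive (0 : R) 1 (fun t => w (L t)) (w1 (L 0) * l).
  apply: (@is_derive1_comp _ w L) => //.
  by apply: jet2_is_derive; apply: w_jet; rewrite L0.
have D := is_deriveD (is_deriveD (is_deriveD vY (is_deriveMl (-1) vX))
  (is_deriveMl (- (2 * C)) wL)) (is_deriveMl eps (is_deriveD gX gY)).
by move=> /(is_derive_locmax D); rewrite L0 => <-; ring.
Qed.

Lemma second_variation pX pY qX qY PX PY QX QY c : -1 < gdist x y / 2 ->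
  jet2 (fun t => v (X t)) 0 pX PX -> jet2 (fun t => v (Y t)) 0 pY PY ->
  jet2 (fun t => g (X t)) 0 qX QX -> jet2 (fun t => g (Y t)) 0 qY QY ->
  L = (fun t => c * t + gdist x y / 2) ->
  PY - PX - 2 * C * (c ^+ 2 * w2 (gdist x y / 2)) + eps * (QX + QY) <= 0.
Proof.
move=> d1 vX vY gX gY LE.
have cL : {for 0, continuous L}.
  by rewrite LE; exact: is_derive_cont (is_derive_affine _ _ _).
have := variation_locmax cL; rewrite LE.
have wL : jet2 w (c * 0 + gdist x y / 2) (w1 (gdist x y / 2)) (w2 (gdist x y / 2)).
  by rewrite mulr0 add0r; exact: w_jet.
have D := jet2D (jet2D (jet2D vY (jet2Z (-1) vX))
  (jet2Z (- (2 * C)) (jet2_affine wL))) (jet2Z eps (jet2D gX gY)).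
by move=> /(jet2_locmax D)[_]; congr (_ <= _); ring.
Qed.

End Variation.
End TwoPoint.

Section Maximum.
Context {R : realType} {M : space_form} {n : nat}.
Variable Om : set (ambient R M n).
Variables (V f f2 : ambient R M n -> R) (lam1 lam2 al : R).
Hypothesis n_gt0 : (0 < n)%N.
Hypothesis Om_domain : domain Om.
Hypothesis Om_convex : geodesically_convex Om.
Hypothesis V_ge0 : forall x, Om x -> 0 <= V x.
Hypothesis f_eigen : eigenfunction Om V lam1 f.
Hypothesis f_gt0 : forall x, Om x -> 0 < f x.
Hypothesis f2_eigen : eigenfunction Om V lam2 f2.
Hypothesis ratio_smooth : smooth_in Om (fun x => f2 x / f x).
Hypothesis al_le : forall x e, Om x -> unit_tangent x e ->
  al <= hess (fun y => - ln (f y)) x e.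
Implicit Types (x y e : ambient R M n) (s t r d : R).

Lemma connecting_geodesic x y : Om x -> Om y -> x != y ->
  0 < gdist x y /\ exists e, [/\ unit_tangent x e, y = geodesic x e (gdist x y) &
    forall t, 0 <= t <= gdist x y -> Om (geodesic x e t)].
Proof.
move=> Ox Oy xy; have pO := domain_points Om_domain.
have [d0 [e ue yE]] := minimal_geodesic n_gt0 (pO x Ox) (pO y Oy) xy.
split=> //; exists e; split=> // t td; have [px te e1] := ue.
have := @Om_convex x (gdist x y *: e) Ox.
have g1 : geodesic x (gdist x y *: e) 1 = y by rewrite geodesicZ // mul1r -yE.
rewrite g1 => /(_ _ Oy).
have tde : tangent x (gdist x y *: e).
  move: te; rewrite /tangent; move: (gdist x y).
  by case: M x e {Ox Oy xy pO d0 ue yE td px e1 g1 y} => //= x e dd; rewrite dotZr => ->; rewrite mulr0.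
rewrite norm2Z e1 mulr1 gtr0_norm // => /(_ tde erefl (t / gdist x y)).
rewrite geodesicZ // divfK ?gt_eqF //; apply.
by rewrite divr_ge0 ?(ltW d0) ?ler_pdivrMr ?mul1r //; lra.
Qed.

Variables (w w1 w2 : R -> R) (b C eps : R).
Hypothesis w_jet : forall t, -1 < t -> jet2 w t (w1 t) (w2 t).
Hypothesis w1_gt0 : forall t, 0 <= t <= b -> 0 < w1 t.
Hypothesis C_ge0 : 0 <= C.
Hypothesis eps_ge0 : 0 <= eps.
Local Notation v := (fun x => f2 x / f x).
Local Notation g := (fun x => ln (f x)).
Local Notation Z := (two_point v g w C eps).

Lemma two_point_max_inequality x y : Om x -> Om y -> x != y ->
  gdist x y / 2 < b ->
  (forall x' y', Om x' -> Om y' -> Z x' y' <= Z x y) ->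
  - (lam2 - lam1) * (v y - v x) <=
    2 * C * (w2 (gdist x y / 2) - 2 * al * (gdist x y / 2) * w1 (gdist x y / 2)) +
    2 * eps * lam1.
Proof.
move=> Ox Oy xy db Zmax; have pO := domain_points Om_domain.
have [d0 [e [ue yE Oe]]] := connecting_geodesic Ox Oy xy.
have d1 : -1 < gdist x y / 2 by lra.
have [i0 [E [E' [oE oE' Ee E'e EE]]]] := parallel_frame (gdist x y) n_gt0 ue.
rewrite -yE in oE'.
have uE i : unit_tangent x (E i) by exact: frame_unit_tangent (pO _ Ox) oE.
have uE' i : unit_tangent y (E' i) by exact: frame_unit_tangent (pO _ Oy) oE'.
have E0 i : geodesic x (E i) 0 = x by have [_ _ ?] := uE i; exact: geodesic0.
have E'0 i : geodesic y (E' i) 0 = y by have [_ _ ?] := uE' i; exact: geodesic0.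
have Ox0 : \forall t \near (0 : R), Om x by near=> t.
have Oy0 : \forall t \near (0 : R), Om y by near=> t.
have OX i : \forall t \near (0 : R), Om (geodesic x (E i) t).
  by apply: near_geodesic_domain => //; rewrite E0.
have OY i : \forall t \near (0 : R), Om (geodesic y (E' i) t).
  by apply: near_geodesic_domain => //; rewrite E'0.
have [p' [P' [q' [Q' [jvx jgx eqx sQx]]]]] :=
  frame_equations Om_domain f_eigen f_gt0 f2_eigen ratio_smooth Ox oE.
have [p [P [q [Q [jvy jgy eqy sQy]]]]] :=
  frame_equations Om_domain f_eigen f_gt0 f2_eigen ratio_smooth Oy oE'.
have YE t : geodesic y (E' i0) t = geodesic x e (gdist x y + t).
  by rewrite E'e [X in geodesic X]yE geodesicD.
have x0 : geodesic x e 0 = x by have [_ _ ?] := ue; exact: geodesic0.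
have dn t : `|t| < gdist x y / 2 -> - (gdist x y / 2) < t < gdist x y / 2.
  by rewrite ltr_norml.
have near_d : \forall t \near (0 : R), `|t| < gdist x y / 2.
  by apply/nbhs_ballP; exists (gdist x y / 2) => [|t] /=;
    rewrite /ball /= ?sub0r ?normrN // divr_gt0.
have cst0 (z : ambient R M n) (h : ambient R M n -> R) :
  is_derive (0 : R) 1 (fun=> h z) 0 by exact: is_derive_cst.
have FV := first_variation (domain_points Om_domain) w_jet w1_gt0 C_ge0 Zmax db.
have SV := second_variation (domain_points Om_domain) w_jet w1_gt0 C_ge0 Zmax db.
set s := gdist x y / 2 in d1 FV SV dn near_d *.
have sE : gdist x y = 2 * s by rewrite /s; field.
have Fy0 : p i0 = C * w1 s - eps * q i0.
  have L0 : 2^-1 * 0 + s = s by rewrite mulr0 add0r.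
  have Lge : \forall t \near (0 : R), gdist x (geodesic y (E' i0) t) / 2 <= 2^-1 * t + s.
    near=> t; have /dn tt : `|t| < s by near: t.
    rewrite YE; have := gdist_geodesic 0 (gdist x y + t) ue.
    by rewrite x0 sub0r normrN ger0_norm; lra.
  have := @FV (fun=> x) (fun t => geodesic y (E' i0) t) _
    erefl (E'0 i0) L0 Ox0 (OY i0) Lge 0 (p i0) 0 (q i0) 2^-1 d1 (cst0 x v)
    (jet2_is_derive (jvy i0)) (cst0 x g) (jet2_is_derive (jgy i0)) (is_derive_affine _ _ _).
  by lra.
have Fx0 : p' i0 = C * w1 s + eps * q' i0.
  have L0 : - 2^-1 * 0 + s = s by rewrite mulr0 add0r.
  have Lge : \forall t \near (0 : R), gdist (geodesic x (E i0) t) y / 2 <= - 2^-1 * t + s.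
    near=> t; have /dn tt : `|t| < s by near: t.
    rewrite Ee; have := gdist_geodesic t (gdist x y) ue.
    by rewrite -yE distrC ger0_norm; lra.
  have := @FV (fun t => geodesic x (E i0) t) (fun=> y) _
    (E0 i0) erefl L0 (OX i0) Oy0 Lge (p' i0) 0 (q' i0) 0 (- 2^-1) d1
    (jet2_is_derive (jvx i0)) (cst0 y v) (jet2_is_derive (jgx i0)) (cst0 y g)
    (is_derive_affine _ _ _).
  by lra.
have yx_perp i : i != i0 -> dot (x - y) (E i) = 0.
  move=> ii; have [_ _ e1] := ue; rewrite [X in x - X]yE.
  by apply: geodesic_chord_normal => //; [exact: oE.1|rewrite -Ee oE.2 eq_sym (negbTE ii)].
have Fyi i : i != i0 -> p i = - eps * q i.
  move=> ii; have perp : dot (x - y) (E' i) = 0 by rewrite EE // yx_perp.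
  have [B [B0 BD Bge]] := gdist_normal_barrier (pO _ Ox) (uE' i) perp d0.
  have L0 : 2^-1 * B 0 = s by rewrite B0 mulrC.
  have Lge : \forall t \near (0 : R), gdist x (geodesic y (E' i) t) / 2 <= 2^-1 * B t.
    by near=> t; have := Bge t; lra.
  have := @FV (fun=> x) (fun t => geodesic y (E' i) t) _
    erefl (E'0 i) L0 Ox0 (OY i) Lge 0 (p i) 0 (q i) (2^-1 * 0) d1 (cst0 x v)
    (jet2_is_derive (jvy i)) (cst0 x g) (jet2_is_derive (jgy i)) (is_deriveMl _ BD).
  by lra.
have Fxi i : i != i0 -> p' i = eps * q' i.
  move=> ii; have perp : dot (y - x) (E i) = 0.
    by rewrite -opprB dotNl yx_perp ?oppr0.
  have d0' : 0 < gdist y x by rewrite gdistC.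
  have [B [B0 BD Bge]] := gdist_normal_barrier (pO _ Oy) (uE i) perp d0'.
  have L0 : 2^-1 * B 0 = s by rewrite B0 gdistC mulrC.
  have Lge : \forall t \near (0 : R), gdist (geodesic x (E i) t) y / 2 <= 2^-1 * B t.
    by near=> t; have := Bge t; rewrite gdistC; lra.
  have := @FV (fun t => geodesic x (E i) t) (fun=> y) _
    (E0 i) erefl L0 (OX i) Oy0 Lge (p' i) 0 (q' i) 0 (2^-1 * 0) d1
    (jet2_is_derive (jvx i)) (cst0 y v) (jet2_is_derive (jgx i)) (cst0 y g)
    (is_deriveMl _ BD).
  by lra.
have S0 : P i0 - P' i0 - 2 * C * w2 s +
    eps * ((Q' i0 - q' i0 ^+ 2) + (Q i0 - q i0 ^+ 2)) <= 0.
  have rev (h : ambient R M n -> R) a c : jet2 (fun t => h (geodesic x (E i0) t)) 0 a c ->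
      jet2 (fun t => h (geodesic x (E i0) (-1 * t + 0))) 0 (-1 * a) ((-1) ^+ 2 * c).
    move=> jh; apply: (@jet2_affine _ (fun t => h (geodesic x (E i0) t)) 0 a c (-1) 0).
    by rewrite mulr0 addr0.
  have L0 : 1 * 0 + s = s by rewrite mulr0 add0r.
  have X0 : geodesic x (E i0) (-1 * 0 + 0) = x by rewrite mulr0 addr0.
  have OXN : \forall t \near (0 : R), Om (geodesic x (E i0) (-1 * t + 0)).
    have c0 : (fun t => -1 * t + 0) @ (0 : R) --> (0 : R).
      have c00 : -1 * 0 + 0 = 0 :> R by rewrite mulr0 addr0.
      rewrite -[X in _ --> X]c00.
      exact: is_derive_cont (is_derive_affine (-1) 0 (0 : R)).
    exact: (c0 _ (OX i0)).
  have Lge : \forall t \near (0 : R),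
      gdist (geodesic x (E i0) (-1 * t + 0)) (geodesic y (E' i0) t) / 2 <= 1 * t + s.
    near=> t; have /dn tt : `|t| < s by near: t.
    rewrite YE Ee; have := gdist_geodesic (-1 * t + 0) (gdist x y + t) ue.
    by rewrite distrC ger0_norm; lra.
  have := @SV (fun t => geodesic x (E i0) (-1 * t + 0)) (fun t => geodesic y (E' i0) t) _
    X0 (E'0 i0) L0 OXN (OY i0) Lge _ _ _ _ _ _ _ _ 1 d1
    (rev v _ _ (jvx i0)) (jvy i0) (rev g _ _ (jgx i0)) (jgy i0) erefl.
  by lra.
have Si i : i != i0 -> P i - P' i +
    eps * ((Q' i - q' i ^+ 2) + (Q i - q i ^+ 2)) <= 0.
  move=> ii.
  have L0 : 0 * 0 + s = s by rewrite mulr0 add0r.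
  have uyE : unit_tangent y (E i) by rewrite -EE.
  have Lge : \forall t \near (0 : R),
      gdist (geodesic x (E i) t) (geodesic y (E' i) t) / 2 <= 0 * t + s.
    near=> t; rewrite EE //; have := gdist_parallel t (uE i) uyE.
    by lra.
  have := @SV (fun t => geodesic x (E i) t) (fun t => geodesic y (E' i) t) _
    (E0 i) (E'0 i) L0 (OX i) (OY i) Lge _ _ _ _ _ _ _ _ 0 d1
    (jvx i) (jvy i) (jgx i) (jgy i) erefl.
  by lra.
have slope : q i0 - q' i0 <= - al * gdist x y.
  apply: (log_slope_le Om_domain f_eigen f_gt0 al_le (ltW d0) ue Oe).
    by have := jgx i0; rewrite Ee; exact.
  by have := jgy i0; rewrite E'e [X in geodesic X]yE; exact.
pose rhs := 2 * C * w2 s + 2 * C * w1 s * (q i0 - q' i0).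
pose T i := P i + 2 * (p i * q i) - (P' i + 2 * (p' i * q' i)) + eps * (Q i + Q' i).
have T_le i : T i <= if i == i0 then rhs else 0.
  rewrite /T; case: ifPn => [/eqP->|ii].
    rewrite Fy0 Fx0 /rhs; have := mulr_ge0 eps_ge0 (sqr_ge0 (q i0)).
    by have := mulr_ge0 eps_ge0 (sqr_ge0 (q' i0)); move: S0; lra.
  rewrite Fyi // Fxi //; have := mulr_ge0 eps_ge0 (sqr_ge0 (q i)).
  by have := mulr_ge0 eps_ge0 (sqr_ge0 (q' i)); have := Si i ii; lra.
have sT : \sum_(i < n) T i <= rhs.
  have := ler_sum (index_enum 'I_n) (fun i (_ : true) => T_le i).
  by rewrite -big_mkcond big_pred1_eq.
have sTE : \sum_(i < n) T i = - (lam2 - lam1) * (v y - v x) + eps * (V y + V x - 2 * lam1).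
  rewrite /T !big_split /= sumrN -!mulr_sumr !big_split /= -!mulr_sumr sQx sQy.
  rewrite eqy eqx; ring.
have w1s : 0 <= 2 * C * w1 s.
  by rewrite !mulr_ge0 // ltW // w1_gt0 //; rewrite ltW ?divr_gt0 ?ltW.
have VV : 0 <= eps * (V y + V x) by rewrite mulr_ge0 // addr_ge0 ?V_ge0.
have := ler_wpM2l w1s slope.
move: sT; rewrite sTE /rhs.
by rewrite sE; lra.
Unshelve. all: by end_near. Qed.

End Maximum.

(** * Compactness and the Lipschitz bound *)

Section Compactness.
Context {R : realType} {m : nat}.
Implicit Types (A : set 'rV[R]_m) (h : 'rV[R]_m -> R).

Lemma bounded_closure_compact A : bounded_set A -> compact (closure A).
Proof.
move=> [K [Kr HK]]; apply: bounded_closed_compact; last exact: closed_closure.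
exists K; split=> // K' KK' x cx.
have clK : closed [set z : 'rV[R]_m | `|z| <= K'].
  apply: (@closed_comp _ _ (fun z : 'rV[R]_m => `|z|) [set r : R | r <= K']).
    by move=> z _; exact: norm_continuous.
  exact: closed_le.
apply: clK; apply: closure_subset cx => z Az; exact: HK.
Qed.

Lemma compact_le_bound A h : compact A -> {within A, continuous h} ->
  exists K, forall x, A x -> `|h x| <= K.
Proof.
move=> cA ch; have := compact_bounded (continuous_compact ch cA).
move=> [K [_ HK]]; exists (K + 1) => x Ax; apply: HK; last by exists x.
by rewrite ltrDl.
Qed.

Lemma superlevel_closed A h c : closed A -> {within A, continuous h} ->
  closed [set x | A x /\ c <= h x].
Proof.
move=> cA /subspace_continuousP ch x clx.
have Ax : A x.
  by apply: cA; apply: closure_subset clx => z [].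
split=> //; rewrite leNgt; apply/negP => hc.
have := ch x Ax _ (lt_nbhsl hc) => /clx[z [[Az cz] /(_ Az)]].
by rewrite /= ltNge cz.
Qed.

End Compactness.

Section Attained.
Context {R : realType} {M : space_form} {n : nat}.
Implicit Types (Om : set (ambient R M n)) (v f : ambient R M n -> R).

Lemma smooth_in_continuous Om v : smooth_in Om v -> {within Om, continuous v}.
Proof.
move=> [U [g [oU OU sg gv]]].
apply: (@subspace_eq_continuous _ _ _ g) => [x /set_mem|]; first exact: gv.
apply: continuous_in_subspaceT => x /set_mem/OU Ux; exact: (sg 0%N).
Qed.

Lemma two_point_attained Om v f (w : R -> R) (C eps K F : R) :
  domain Om -> bounded_set Om -> {within closure Om, continuous f} ->
  (forall x, boundary Om x -> f x = 0) -> (forall x, Om x -> 0 < f x) ->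
  {within Om, continuous v} ->
  (forall x y, Om x -> Om y -> v y - v x <= K) -> (forall x, Om x -> f x <= F) ->
  (forall t, 0 <= t -> {for t, continuous w}) ->
  (forall x y, Om x -> Om y -> 0 <= w (gdist x y / 2)) ->
  0 <= C -> 0 < eps ->
  exists x y, [/\ Om x, Om y & forall x' y', Om x' -> Om y' ->
    two_point v (fun x => ln (f x)) w C eps x' y' <=
    two_point v (fun x => ln (f x)) w C eps x y].
Proof.
move=> dO bO cf f0 fpos cv vK fF cw w0 C0 e0.
have pO := domain_points dO.
have [x0 Ox0] : Om !=set0 by case: dO.
set Z := two_point _ _ _ _ _.
pose z0 := Z x0 x0.
pose de := expR ((z0 - K) / eps - ln F - 1).
have F0 : 0 < F := lt_le_trans (fpos _ Ox0) (fF _ Ox0).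
have lnF x : Om x -> ln (f x) <= ln F.
  by move=> Ox; rewrite ler_ln ?posrE ?fF // fpos.
have lnd x : Om x -> f x < de -> ln (f x) < (z0 - K) / eps - ln F - 1.
  by move=> Ox fd; rewrite -[ltRHS]expRK ltr_ln ?posrE ?fpos // expR_gt0.
have Zle x y : Om x -> Om y -> Z x y <= K + eps * (ln (f x) + ln (f y)).
  move=> Ox Oy; rewrite /Z /two_point lerD2r.
  have := vK x y Ox Oy; have := mulr_ge0 C0 (w0 x y Ox Oy); lra.
have Zlow x y : Om x -> Om y -> f x < de \/ f y < de -> Z x y < z0.
  move=> Ox Oy fxy; apply: le_lt_trans (Zle x y Ox Oy) _.
  have : ln (f x) + ln (f y) < (z0 - K) / eps.
    by case: fxy => [/(lnd x Ox)|/(lnd y Oy)]; have := lnF x Ox; have := lnF y Oy; lra.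
  by rewrite ltr_pdivlMr //; lra.
pose S := [set x | closure Om x /\ de <= f x].
have SO x : S x -> Om x.
  move=> [cx dx]; apply: contrapT => Ox.
  by have := f0 x (conj cx Ox); have := expR_gt0 ((z0 - K) / eps - ln F - 1); rewrite -/de; lra.
have OS x : Om x -> de <= f x -> S x by move=> Ox; split=> //; exact: subset_closure.
have cS : compact S.
  apply: bounded_closed_compact.
    case: bO => k [kr kO]; exists k; split=> // k' kk' x /SO; exact: kO.
  exact: superlevel_closed (@closed_closure _ _) cf.
have x0S : S x0.
  apply: OS => //; rewrite leNgt; apply/negP => lt.
  by have := Zlow x0 x0 Ox0 Ox0 (or_introl lt); rewrite ltxx.
have ZC : {within S `*` S, continuous (fun p => Z p.1 p.2)}.
  apply/subspace_continuousP => -[x y] [/= Sx Sy].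
  have Ox := SO x Sx; have Oy := SO y Sy.
  pose G := within (S `*` S) (nbhs (x, y)).
  have G1 : (fun p => p.1) @ G --> x by apply: cvg_within_filter; exact: cvg_fst.
  have G2 : (fun p => p.2) @ G --> y by apply: cvg_within_filter; exact: cvg_snd.
  have GO : \forall p \near G, Om p.1 /\ Om p.2.
    have : \forall p \near G, (S `*` S) p by exact: near_withinT.
    by apply: filterS => p [S1 S2]; split; apply: SO.
  have comp (h : ambient R M n -> R) (q : ambient R M n * ambient R M n -> ambient R M n)
      A z : Om z -> Om `<=` A -> {within A, continuous h} -> q @ G --> z ->
      (\forall p \near G, Om (q p)) -> (fun p => h (q p)) @ G --> h z.
    move=> Oz OA /subspace_continuousP ch qz qO W /(ch z (OA _ Oz)) hW.
    have hW' : \forall p \near G, A (q p) -> W (h (q p)) := qz _ hW.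
    by apply: filterS2 hW' qO => p hp /OA /hp.
  have GO1 : \forall p \near G, Om p.1 by apply: filterS GO => p [].
  have GO2 : \forall p \near G, Om p.2 by apply: filterS GO => p [].
  have fO : Om `<=` closure Om by exact: subset_closure.
  have v1 := comp v fst Om x Ox (@subset_refl _ Om) cv G1 GO1.
  have v2 := comp v snd Om y Oy (@subset_refl _ Om) cv G2 GO2.
  have f1 := comp f fst _ x Ox fO cf G1 GO1.
  have f2 := comp f snd _ y Oy fO cf G2 GO2.
  have l1 : (fun p => ln (f p.1)) @ G --> ln (f x).
    exact: (cvg_comp _ _ f1 (continuous_ln (fpos x Ox))).
  have l2 : (fun p => ln (f p.2)) @ G --> ln (f y).
    exact: (cvg_comp _ _ f2 (continuous_ln (fpos y Oy))).
  have d1 : (fun p => gdist p.1 p.2) @ G --> gdist x y.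
    apply: cvg_gdist => //; [exact: pO|exact: pO|].
    by apply: filterS GO => p [/pO ? /pO ?].
  have d2 : (fun p => gdist p.1 p.2 / 2) @ G --> gdist x y / 2.
    by apply: cvgM => //; exact: cvg_cst.
  have wd : (fun p => w (gdist p.1 p.2 / 2)) @ G --> w (gdist x y / 2).
    apply: (cvg_comp _ _ d2); apply: cw.
    by rewrite divr_ge0 // gdist_ge0 //; exact: pO.
  rewrite /Z /two_point; apply: cvgD; first apply: cvgD; first apply: cvgD => //.
  - by apply: cvgM => //; exact: cvg_cst.
  - by apply: cvgM => //; exact: cvg_cst.
  - by apply: cvgM; [exact: cvg_cst|exact: cvgD].
have [||[x y] /set_mem[/= Sx Sy] Zmax] := @compact_EVT_max _ _ _ (S `*` S) _ _ ZC.
- by exists (x0, x0).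
- exact: compact_setX.
exists x, y; split; [exact: SO|exact: SO|move=> x' y' Ox' Oy'].
have z0le : z0 <= Z x y by apply: (Zmax (x0, x0)); apply/mem_set.
have [lt|le1] := ltP (f x') de.
  by apply: le_trans z0le; apply/ltW/Zlow => //; left.
have [lt|le2] := ltP (f y') de.
  by apply: le_trans z0le; apply/ltW/Zlow => //; right.
by apply: (Zmax (x', y')); apply/mem_set; split; apply: OS.
Unshelve. all: by end_near. Qed.

End Attained.

Section Lipschitz.
Context {R : realType}.

Lemma norm_coord_le m (u : 'rV[R]_m) i : `|u 0 i| <= norm2 u.
Proof.
rewrite -(ler_pXn2r (n := 2)) ?nnegrE ?sqrtr_ge0 // norm2_sqr /dot real_normK ?num_real //.
rewrite (bigD1 i) //= -expr2 lerDl; apply: sumr_ge0 => j _.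
by rewrite -expr2 sqr_ge0.
Qed.

Lemma directional_derivative_bound m (A U : set 'rV[R]_m) (g : 'rV[R]_m -> R) :
  compact A -> A `<=` U -> smooth U g ->
  exists L, 0 <= L /\ forall x u, A x -> norm2 u = 1 -> `|'D_u g x| <= L.
Proof.
move=> cA AU sg; have [dg Dg] := sg 1%N.
have bi i : exists K, forall x, A x -> `|'D_(delta_mx 0 i) g x| <= K.
  apply: (compact_le_bound cA); apply: continuous_in_subspaceT => x /set_mem/AU Ux.
  exact: (Dg (delta_mx 0 i)).
have [K HK] := choice bi.
exists (\sum_(i < m) `|K i|); split; first exact: sumr_ge0.
move=> x u Ax u1; have dgx := dg x (AU x Ax).
rewrite deriveE // [X in 'd g x X]row_sum_delta linear_sum /=.
apply: le_trans (ler_norm_sum _ _ _) _; apply: ler_sum => i _.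
rewrite linearZ /= normrM -deriveE //.
apply: le_trans (ler_pM (normr_ge0 _) (normr_ge0 _) (norm_coord_le u i) (HK i x Ax)) _.
by rewrite u1 mul1r ler_norm.
Qed.

Context {M : space_form} {n : nat}.
Implicit Types (x y e : ambient R M n).

Lemma geodesic_derive0 (g : ambient R M n -> R) x e : differentiable g x ->
  unit_tangent x e -> is_derive (0 : R) 1 (fun s => g (geodesic x e s)) ('D_e g x).
Proof.
move=> dg [_ _ e1]; have g0 := geodesic0 x e1.
have bD : is_derive (0 : R) 1 (base_coef M) 0.
  rewrite /base_coef; case: (M); first exact: is_derive_cst.
  by apply: (is_derive_eq (is_derive_cos (0 : R))); rewrite sin0 oppr0.
have dD : is_derive (0 : R) 1 (dir_coef M) 1.
  rewrite /dir_coef; case: (M); first exact: (@is_derive_id R R^o).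
  by apply: (is_derive_eq (is_derive_sin (0 : R))); rewrite cos0.
have gE : geodesic x e = fun s => base_coef M s *: x + dir_coef M s *: e.
  by apply/funext => s; exact: geodesicE.
rewrite gE in g0 *.
have dg0 : differentiable g (base_coef M 0 *: x + dir_coef M 0 *: e) by rewrite g0.
by apply: (is_derive_eq (is_derive_curve dg0 bD dD)); rewrite mul0r add0r mul1r g0.
Qed.

Variable Om : set (ambient R M n).
Hypothesis n_gt0 : (0 < n)%N.
Hypothesis Om_domain : domain Om.
Hypothesis Om_bounded : bounded_set Om.
Hypothesis Om_convex : geodesically_convex Om.

Lemma smooth_lipschitz v : smooth_up_to_boundary Om v ->
  exists L, 0 <= L /\ forall x y, Om x -> Om y -> v y - v x <= L * gdist x y.
Proof.
move=> [U [g [oU cU sg gv]]].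
have cO := bounded_closure_compact Om_bounded.
have [L [L0 HL]] := directional_derivative_bound cO cU sg.
exists L; split=> // x y Ox Oy; have [dg _] := sg 1%N.
have pO := domain_points Om_domain.
have [->|xy] := eqVneq x y.
  by rewrite subrr mulr_ge0 // gdist_ge0 //; exact: pO.
have [d0 [e [ue yE Oe]]] := connecting_geodesic n_gt0 Om_domain Om_convex Ox Oy xy.
rewrite -(gv x Ox) -(gv y Oy).
pose h s := g (geodesic x e s).
have hD s : 0 <= s <= gdist x y -> is_derive s 1 h ('D_(velocity x e s) g (geodesic x e s)).
  move=> sd; have Os := Oe s sd; have us := unit_tangent_geodesic s ue.
  have := geodesic_derive0 (dg _ (cU _ (subset_closure Os))) us.
  have -> : (fun t => g (geodesic (geodesic x e s) (velocity x e s) t)) =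
      (fun t => h (1 * t + s)).
    by apply/funext => t; rewrite geodesicD // mul1r addrC.
  move=> D; have ss : 0 = 1 * s + (- s) by ring.
  rewrite ss in D.
  have := is_derive_comp_affine D; rewrite mul1r.
  by have -> : (fun t => h (1 * (1 * t + - s) + s)) = h
    by apply/funext => t; congr h; ring.
have h0 : h 0 = g x by rewrite /h geodesic0 //; case: ue.
have hd : h (gdist x y) = g y by rewrite /h -yE.
rewrite -h0 -hd.
have := @is_derive_growth R (fun s => -1 * h s)
  (fun s => -1 * 'D_(velocity x e s) g (geodesic x e s)) (- L) 0 (gdist x y) (ltW d0).
move=> /(_ _ _) G; have {G} : - L * (gdist x y - 0) <= -1 * h (gdist x y) - -1 * h 0.
  apply: G => s sd; first exact: is_deriveMl (hD s sd).
  have [_ _ v1] := unit_tangent_geodesic s ue.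
  have := HL _ _ (subset_closure (Oe s sd)) v1.
  by rewrite ler_norml; lra.
by lra.
Qed.

Lemma gdist_le_diameter x y : Om x -> Om y -> gdist x y <= diameter Om.
Proof.
move=> Ox Oy; apply: ub_le_sup; last by exists x => //; exists y.
have pO := domain_points Om_domain.
have [K HK] : exists K, forall z, Om z -> M = Euclidean -> norm2 z <= K.
  have cO := bounded_closure_compact Om_bounded.
  have cN : {within closure Om, continuous (fun z : ambient R M n => norm2 z)}.
    apply: continuous_subspaceT => z.
    have dz : (fun z : ambient R M n => dot z z) @ z --> dot z z.
      have idz : id @ z --> z by exact: cvg_id.
      exact: (dot_continuous (nbhs_filter z) idz idz).
    exact: (cvg_comp _ _ dz (@sqrt_continuous R _)).
  have [K HK] := compact_le_bound cO cN.
  exists K => z Oz _; exact: le_trans (ler_norm _) (HK _ (subset_closure Oz)).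
exists (Num.max pi (2 * K)) => _ [a Oa [c Oc <-]].
have := HK a Oa; have := HK c Oc; have := @dot_points R M n a c.
move: (pO a Oa) (pO c Oc); rewrite /gdist; case: M a c {Oa Oc} => a c pa pc.
  move=> _ /(_ erefl) c1 /(_ erefl) a1; rewrite le_max; apply/orP; right.
  have K0 : 0 <= K := le_trans (sqrtr_ge0 _) a1.
  rewrite -(ler_pXn2r (n := 2)) ?nnegrE ?sqrtr_ge0 ?mulr_ge0 // norm2_sqr.
  have := dot_ge0 (a + c); have := norm2_sqr a; have := norm2_sqr c.
  have : norm2 a ^+ 2 <= K ^+ 2 by rewrite ler_pXn2r ?nnegrE ?sqrtr_ge0.
  have : norm2 c ^+ 2 <= K ^+ 2 by rewrite ler_pXn2r ?nnegrE ?sqrtr_ge0.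
  by rewrite !dotE (dotC c a); lra.
move=> /(_ erefl pa pc) c1 _ _; rewrite le_max acos_lepi //.
Qed.

End Lipschitz.

(** * The gap estimate *)

Section Comparison.
Context {R : realType} {M : space_form} {n : nat}.
Variable Om : set (ambient R M n).
Variables (V f f2 : ambient R M n -> R) (lam1 lam2 al : R).
Hypothesis n_gt0 : (0 < n)%N.
Hypothesis Om_domain : domain Om.
Hypothesis Om_bounded : bounded_set Om.
Hypothesis Om_convex : geodesically_convex Om.
Hypothesis V_ge0 : forall x, Om x -> 0 <= V x.
Hypothesis f_eigen : eigenfunction Om V lam1 f.
Hypothesis f_gt0 : forall x, Om x -> 0 < f x.
Hypothesis f2_eigen : eigenfunction Om V lam2 f2.
Hypothesis ratio_smooth : smooth_up_to_boundary Om (fun x => f2 x / f x).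
Hypothesis al_le : forall x e, Om x -> unit_tangent x e ->
  al <= hess (fun y => - ln (f y)) x e.
Hypothesis lam_ge0 : 0 <= lam2 - lam1.
Local Notation v := (fun x => f2 x / f x).

Section Contraction.
Variables (w w1 w2 : R -> R) (b mu : R).
Hypothesis w0 : w 0 = 0.
Hypothesis w_jet : forall t, -1 < t -> jet2 w t (w1 t) (w2 t).
Hypothesis w1_gt0 : forall t, 0 <= t <= b -> 0 < w1 t.
Hypothesis w_ineq : forall t, 0 <= t <= b -> w2 t - 2 * al * t * w1 t <= - mu * w t.
Hypothesis Om_lt : forall x y, Om x -> Om y -> gdist x y / 2 < b.

Lemma modulus_contraction C C' : 0 < C -> 0 <= C' -> C * (lam2 - lam1) < C' * mu ->
  (forall x y, Om x -> Om y -> v y - v x <= 2 * C * w (gdist x y / 2)) ->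
  forall x y, Om x -> Om y -> v y - v x <= 2 * C' * w (gdist x y / 2).
Proof.
move=> C0 C'0 CC' vC x0 y0 Ox0 Oy0; rewrite leNgt; apply/negP => lt0.
have pO := domain_points Om_domain.
have hd x y : Om x -> Om y -> 0 <= gdist x y / 2 <= b.
  move=> Ox Oy; apply/andP; split; last exact: ltW (Om_lt Ox Oy).
  by rewrite divr_ge0 // gdist_ge0 //; exact: pO.
have w_ge0 x y : Om x -> Om y -> 0 <= w (gdist x y / 2).
  move=> Ox Oy; rewrite -w0; have /andP[? ?] := hd x y Ox Oy.
  exact: (model_nondecreasing w_jet w1_gt0).
have [[_ cf] f_bd _ _] := f_eigen.
have [F0 HF0] := compact_le_bound (bounded_closure_compact Om_bounded) cf.
have fF x : Om x -> f x <= F0.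
  by move=> Ox; apply: le_trans (ler_norm _) (HF0 _ (subset_closure Ox)).
have [L [L0 HL]] := smooth_lipschitz n_gt0 Om_domain Om_bounded Om_convex ratio_smooth.
have vK x y : Om x -> Om y -> v y - v x <= L * diameter Om.
  move=> Ox Oy; apply: le_trans (HL x y Ox Oy) _; rewrite ler_wpM2l //.
  exact: gdist_le_diameter.
have cw t : 0 <= t -> {for t, continuous w}.
  by move=> t0; apply: is_derive_cont (jet2_is_derive (w_jet _)); lra.
have ratio_in := smooth_up_to_boundary_in ratio_smooth.
pose g x := ln (f x).
pose eta := v y0 - v x0 - 2 * C' * w (gdist x0 y0 / 2).
have eta0 : 0 < eta by rewrite /eta; lra.
pose kap := (C' * mu - C * (lam2 - lam1)) * (eta / (4 * C)).
have kap0 : 0 < kap by rewrite mulr_gt0 ?divr_gt0 ?mulr_gt0 //; lra.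
pose B := 1 + `|g x0 + g y0| + 2 * `|ln F0| + `|lam1|.
have B0 : 0 < B.
  by rewrite /B; have := normr_ge0 (g x0 + g y0); have := normr_ge0 (ln F0);
    have := normr_ge0 lam1; lra.
pose eps := Num.min (eta / 4) (kap / 2) / B.
have mn0 : 0 < Num.min (eta / 4) (kap / 2) by rewrite lt_min !divr_gt0.
have eps0 : 0 < eps by rewrite divr_gt0.
have epsB c : `|c| <= B -> eps * c <= eta / 4 /\ eps * c <= kap / 2.
  move=> cB; have : eps * c <= Num.min (eta / 4) (kap / 2).
    rewrite /eps -mulrA ler_piMr ?(ltW mn0) // mulrC ler_pdivrMr // mul1r.
    exact: le_trans (ler_norm _) cB.
  by rewrite le_min => /andP[].
have [x [y [Ox Oy Zmax]]] := two_point_attained Om_domain Om_bounded cf f_bd f_gt0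
  (smooth_in_continuous ratio_in) vK fF cw w_ge0 C'0 eps0.
have Z0 := Zmax x0 y0 Ox0 Oy0.
have lnF z : Om z -> g z <= ln F0.
  move=> Oz; rewrite /g ler_ln ?posrE ?fF ?f_gt0 //.
  by apply: lt_le_trans (fF z Oz); exact: f_gt0.
have [e1 _] : eps * - (g x0 + g y0) <= eta / 4 /\ eps * - (g x0 + g y0) <= kap / 2.
  apply: epsB; rewrite normrN /B.
  by have := normr_ge0 (ln F0); have := normr_ge0 lam1; lra.
have [e2 _] : eps * (2 * ln F0) <= eta / 4 /\ eps * (2 * ln F0) <= kap / 2.
  apply: epsB; rewrite normrM ger0_norm // /B.
  by have := normr_ge0 (g x0 + g y0); have := normr_ge0 lam1; lra.
have [_ e3] : eps * lam1 <= eta / 4 /\ eps * lam1 <= kap / 2.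
  apply: epsB; rewrite /B.
  by have := normr_ge0 (g x0 + g y0); have := normr_ge0 (ln F0); lra.
have gxy : eps * (g x + g y) <= eps * (2 * ln F0).
  by rewrite ler_pM2l //; have := lnF x Ox; have := lnF y Oy; lra.
have gap : eta / 2 <= v y - v x - 2 * C' * w (gdist x y / 2).
  by move: Z0 e1 e2 gxy; rewrite /two_point /eta -/(g x0) -/(g y0) -/(g x) -/(g y); lra.
have xy : x != y.
  apply: contraTneq gap => xyE; rewrite -ltNge xyE subrr.
  have := mulr_ge0 C'0 (w_ge0 y y Oy Oy); lra.
have := two_point_max_inequality n_gt0 Om_domain Om_convex V_ge0 f_eigen f_gt0
  f2_eigen ratio_in al_le w_jet w1_gt0 C'0 (ltW eps0) Ox Oy xy (Om_lt Ox Oy) Zmax.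
have wi := ler_wpM2l C'0 (w_ineq (hd x y Ox Oy)).
have vc := vC x y Ox Oy.
have lc := ler_wpM2l lam_ge0 vc.
have wpos := w_ge0 x y Ox Oy.
set W := w (gdist x y / 2) in wi vc lc wpos gap *.
have W_ge : eta / (4 * C) <= W.
  rewrite ler_pdivrMr ?mulr_gt0 //; have := mulr_ge0 C'0 wpos; lra.
have cc0 : 0 < C' * mu - C * (lam2 - lam1) by lra.
have := ler_wpM2l (ltW cc0) W_ge; rewrite -/kap.
by lra.
Qed.

End Contraction.

Lemma spectral_gap_ge x0 y0 : Om x0 -> Om y0 -> v x0 < v y0 ->
  pi ^+ 2 / diameter Om ^+ 2 + al <= lam2 - lam1.
Proof.
move=> Ox0 Oy0 v0; rewrite leNgt; apply/negP => gap.
have pO := domain_points Om_domain.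
have [L [L0 HL]] := smooth_lipschitz n_gt0 Om_domain Om_bounded Om_convex ratio_smooth.
set D := diameter Om in gap.
have dD x y : Om x -> Om y -> gdist x y <= D by exact: gdist_le_diameter.
have D0 : 0 < D.
  apply: lt_le_trans (dD x0 y0 Ox0 Oy0).
  have xy : x0 != y0 by apply: contraTneq v0 => ->; rewrite ltxx.
  by have [] := minimal_geodesic n_gt0 (pO x0 Ox0) (pO y0 Oy0) xy.
set lam := lam2 - lam1 in gap.
have lam0 : 0 <= lam := lam_ge0.
have pD0 : 0 < pi / D by rewrite divr_gt0 // pi_gt0.
pose m0 := Num.max 0 (lam - al).
have m0lt : m0 < (pi / D) ^+ 2 by rewrite gt_max exprn_gt0 //= expr_div_n; lra.
have m0ge : 0 <= m0 by rewrite le_max lexx.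
have m0ge' : lam - al <= m0 by rewrite le_max lexx orbT.
pose be := Num.sqrt ((m0 + (pi / D) ^+ 2) / 2).
have be2 : be ^+ 2 = (m0 + (pi / D) ^+ 2) / 2 by rewrite sqr_sqrtr //; lra.
have be0 : 0 < be by rewrite sqrtr_gt0; lra.
have beD : be < pi / D.
  by rewrite -(ltr_pXn2r (n := 2)) ?nnegrE ?ltW // be2; lra.
have beD' : D < pi / be by rewrite ltr_pdivlMr // mulrC -ltr_pdivlMr.
pose b := (D / 2 + pi / be / 2) / 2.
have b1 : D / 2 < b by rewrite /b; lra.
have bb : be * b < pi / 2.
  by rewrite mulrC -ltr_pdivlMr // /b mulrAC; lra.
have [|w [w1 [w2 [w0 wj w1p wi [c c0 wc]]]]] := model_function al be0 _ bb; first lra.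
have Om_lt x y : Om x -> Om y -> gdist x y / 2 < b.
  by move=> Ox Oy; have := dD x y Ox Oy; lra.
pose mu := al + be ^+ 2.
have mulam : lam < mu by rewrite /mu be2; lra.
have mu0 : 0 < mu by lra.
have wi' t : 0 <= t <= b -> w2 t - 2 * al * t * w1 t <= - mu * w t := wi t.
pose C0 := (L + 1) / c.
have C00 : 0 < C0 by rewrite divr_gt0 //; lra.
have vC0 x y : Om x -> Om y -> v y - v x <= 2 * C0 * w (gdist x y / 2).
  move=> Ox Oy; have d0 := gdist_ge0 (pO x Ox) (pO y Oy).
  have d2 := Om_lt x y Ox Oy.
  have cw : c * (gdist x y / 2) <= w (gdist x y / 2) by apply: wc; lra.
  have := ler_wpM2l (ltW C00) cw.
  have -> : C0 * (c * (gdist x y / 2)) = (L + 1) * gdist x y / 2.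
    by rewrite /C0; field; exact: lt0r_neq0.
  by have := HL x y Ox Oy; lra.
pose th := (lam + mu) / (2 * mu).
have th0 : 0 < th by rewrite divr_gt0 ?mulr_gt0 //; lra.
have th1 : th < 1 by rewrite ltr_pdivrMr ?mulr_gt0 //; lra.
have thmu : th * mu = (lam + mu) / 2 by rewrite /th; field; exact: lt0r_neq0.
have vCk k : forall x y, Om x -> Om y -> v y - v x <= 2 * (th ^+ k * C0) * w (gdist x y / 2).
  elim: k => [|k IH]; first by rewrite expr0 mul1r.
  have tk : 0 < th ^+ k * C0 by rewrite mulr_gt0 ?exprn_gt0.
  have tk' : 0 <= th ^+ k.+1 * C0 by rewrite ltW // mulr_gt0 ?exprn_gt0.
  apply: (modulus_contraction w0 wj w1p wi' Om_lt tk tk' _ IH).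
  have -> : th ^+ k.+1 * C0 * mu = th ^+ k * C0 * ((lam + mu) / 2).
    by rewrite -thmu exprS; ring.
  by rewrite ltr_pM2l // -/lam; lra.
pose S := 2 * C0 * w (gdist x0 y0 / 2).
have cv : (fun k => th ^+ k * S) @ \oo --> 0.
  rewrite -[X in _ --> X](mul0r S); apply: cvgM; last exact: cvg_cst.
  by apply: cvg_expr; rewrite ger0_norm // ltW.
have : \forall k \near \oo, th ^+ k * S < v y0 - v x0.
  have vv : 0 < v y0 - v x0 by rewrite subr_gt0.
  exact: (cv _ (lt_nbhsl vv)).
move=> [N _ /(_ N (leqnn N))] /=.
have := vCk N x0 y0 Ox0 Oy0; rewrite /S; lra.
Qed.

End Comparison.

Lemma domain_dim_gt0 (R : realType) (M : space_form) (n : nat)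
    (Om : set (ambient R M n)) x y :
  domain Om -> Om x -> Om y -> x != y -> (0 < n)%N.
Proof.
move=> dO Ox Oy; case: n Om x y dO Ox Oy => // Om x y dO Ox Oy; apply: contra_neqT => _.
have pO := domain_points dO; have [_ _ cO] := dO.
case: M Om x y dO Ox Oy pO cO => Om x y dO Ox Oy pO cO.
  by apply/rowP => -[].
have E (z : 'rV[R]_1) : Om z -> z 0 0 * z 0 0 = 1.
  by move=> /pO; rewrite /points /= /dot big_ord1.
have : connected ((fun z : 'rV[R]_1 => z 0 0) @` Om).
  apply: connected_continuous_connected => //.
  by apply: continuous_subspaceT => z; exact: coord_continuous.
move=> /connected_intervalP itv.
have no0 : ~ ((fun z : 'rV[R]_1 => z 0 0) @` Om) 0.
  by move=> [z /E zz z0]; move: zz; rewrite z0 mul0r => /eqP; rewrite eq_sym oner_eq0.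
have sgn a c : Om a -> Om c -> a 0 0 < 0 -> 0 < c 0 0 -> False.
  move=> Oa Oc a0 c0; apply: no0.
  by apply: (itv (a 0 0) (c 0 0)); [exists a|exists c|rewrite !ltW].
apply/rowP => i; rewrite ord1; have xx := E x Ox; have yy := E y Oy.
have : (x 0 0 - y 0 0) * (x 0 0 + y 0 0) == 0 by apply/eqP; lra.
rewrite mulf_eq0 => /orP[/eqP|/eqP] xy; first lra.
have [x0|x0|x0] := ltgtP (x 0 0) 0.
- by case: (sgn x y Ox Oy) => //; lra.
- by case: (sgn y x Oy Ox) => //; lra.
- by rewrite x0 in xx; lra.
Qed.

Lemma unit_tangent_exists (R : realType) (M : space_form) (n : nat)
    (Om : set (ambient R M n)) x : (0 < n)%N -> domain Om -> Om x ->
  exists e, unit_tangent x e.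
Proof.
move=> n0 dO /(domain_points dO); rewrite /unit_tangent /points /tangent.
case: M Om x dO => Om x _ px /=.
  by have [u [u1 _]] := @exists_unit_normal R n 0 (fun=> x) n0; exists u.
have [u [u1 xu]] := @exists_unit_normal R n.+1 1 (fun=> x) n0; exists u.
by split=> //; exact: (xu 0%N).
Qed.

Theorem theorem3 (R : realType) (M : space_form) (n : nat)
    (Om : set (ambient R M n)) (V f f2 : ambient R M n -> R)
    (lam1 lam2 k : R)
    (Om_domain : domain Om) (Om_bounded : bounded_set Om)
    (Om_smooth : smooth_boundary Om) (Om_convex : strictly_convex Om)
    (V_ge0 : forall x, Om x -> 0 <= V x)
    (V_convex : convex_potential Om V) (V_smooth : smooth_in Om V)
    (lam12 : first_two_eigenvalues Om V lam1 lam2)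
    (f_eigen : eigenfunction Om V lam1 f) (f_gt0 : forall x, Om x -> 0 < f x)
    (f2_eigen : eigenfunction Om V lam2 f2)
    (ratio_smooth : smooth_up_to_boundary Om (fun x => f2 x / f x))
    (ratio_sup : sup [set f2 x / f x | x in Om] = 1)
    (ratio_inf : inf [set f2 x / f x | x in Om] = - k)
    (k_range : 0 < k <= 1)
    (a0 : midrange k = 0) :
  ((pi ^+ 2 / diameter Om ^+ 2)%:E + alpha Om f <= (lam2 - lam1)%:E)%E.
Proof.
pose v x := f2 x / f x.
have [x0 [y0 [Ox0 Oy0 v0]]] : exists x y, [/\ Om x, Om y & v x < v y].
  apply: contrapT => nv; have [a Oa] : Om !=set0 by case: Om_domain.
  have vE : [set f2 x / f x | x in Om] = [set v a].
    apply/seteqP; split=> [_ [x Ox <-]|_ ->]; last by exists a.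
    apply/eqP; rewrite eq_le !leNgt; apply/andP; split; apply/negP => lt; apply: nv.
      by exists a, x.
    by exists x, a.
  by move: ratio_sup ratio_inf; rewrite vE sup1 inf1 => ->; lra.
have n0 : (0 < n)%N.
  by apply: (domain_dim_gt0 Om_domain Ox0 Oy0); apply: contraTneq v0 => ->; rewrite ltxx.
have lam_ge0 : 0 <= lam2 - lam1.
  by case: lam12 => u1 [u2 [_ _ low _]]; rewrite subr_ge0; exact: low f2_eigen.
have al_le x e : Om x -> unit_tangent x e ->
    (alpha Om f <= (hess (fun y => - ln (f y)) x e)%:E)%E.
  move=> Ox [_ te e1]; apply: le_trans (ereal_inf_lbound _) _.
    by exists x => //; reflexivity.
  by apply: ereal_inf_lbound; exists e.
case: (alpha Om f) al_le => [al al_le|al_le|_].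
- rewrite -EFinD lee_fin.
  apply: (spectral_gap_ge n0 Om_domain Om_bounded Om_convex.1 V_ge0 f_eigen f_gt0
    f2_eigen ratio_smooth _ lam_ge0 Ox0 Oy0 v0) => x e Ox ue.
  by rewrite -lee_fin; exact: al_le.
- have [e ue] := unit_tangent_exists n0 Om_domain Ox0.
  by have := al_le x0 e Ox0 ue.
- by rewrite addeNy leNye.
Qed.
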